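(* Let $M=(\mathfrak{U},d,P)$ be the Fraïssé limit of the class $\mathcal{K}$. Then $Th(M)$ is separably categorical, and the $\mathbf{t}$-closed set $Y_P\subseteq\mathfrak{U}_L$ corresponding to $Th(M)$ (i.e. the set of all $L$-structures in $\mathfrak{U}_L$ satisfying all conditions of $Th(M)$) is relatively stable.
   Context: Continuous logic: structures are complete metric structures of diameter $\le 1$ with $[0,1]$-valued uniformly continuous predicates; first-order formulas are built from atomic formulas using the countable family of connectives $1-x$, $x/2$, $x\dot{-}y=\max(x-y,0)$, $\min$, $\max$, truncated multiplication by positive rationals, and the quantifiers $\sup,\inf$. $Th(M)$ is the set of all conditions $\phi=0$ ($\phi$ a sentence) true in $M$. A theory is separably categorical if it has, up to isomorphism, exactly one separable model. For a theory $T$ the distance between complete types in the same finite tuple of variables is $d(p,q)=\inf\{d(\bar c,\bar b): \text{there is a model of } T \text{ in which } \bar c\models p,\ \bar b\models q\}$, where tuples carry the max metric. $\mathfrak{U}$ is the Urysohn space of diameter $1$ (the unique Polish metric space of diameter $1$ that is ultrahomogeneous and universal for separable metric spaces of diameter $\le1$), viewed as a structure in the signature $\langle d\rangle$. $\mathbb{Q}\mathfrak{U}$ is the rational Urysohn space of diameter $1$ (the countable ultrahomogeneous metric space with rational distances universal for countable metric spaces with rational distances and diameter $\le 1$), embedded in $\mathfrak{U}$ so that it is dense in $\mathfrak{U}$, every isometry of $\mathbb{Q}\mathfrak{U}$ extends to an isometry of $\mathfrak{U}$, and $\mathrm{Iso}(\mathbb{Q}\mathfrak{U})$ is dense in $\mathrm{Iso}(\mathfrak{U})$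 (pointwise convergence topology). $L=(d,P)$ with $P$ a unary predicate symbol with continuity modulus $\mathrm{id}$ (so $P$ is $1$-Lipschitz); $\mathcal{L}$ is the set of first-order continuous $L$-formulas. $\mathfrak{U}_L$ is the space of all $L$-structures on the metric space $(\mathfrak{U},d)$; $\mathbf{t}$ is the topology on it with basis consisting of the sets $\{A\in\mathfrak{U}_L:\phi^A(\bar s)<r\}$, $\phi\in\mathcal{L}$, $\bar s\in\mathbb{Q}\mathfrak{U}$, $r\in\mathbb{Q}\cap(0,1)$. $\mathcal{K}$ is the class of all finite structures $(A,d,P)$, $(A,d)$ a metric space, for which there are a metric space $B\supseteq A$ of diameter $\le1$ and a nonempty $B_0\subseteq B$ with $P(x)=d(x,B_0)=\inf_{b\in B_0}d(x,b)$ for all $x\in A$. The Fraïssé limit of $\mathcal{K}$ (unique up to isomorphism) is the separable complete $L$-structure $M$ all of whose finite substructures belong to $\mathcal{K}$ and such that for all $A\subseteq A'$ in $\mathcal{K}$, every embedding $f:A\to M$ and every $\varepsilon>0$ there is an embedding $g:A'\to M$ with $d(g(a),f(a))\le\varepsilon$ for all $a\in A$. Its underlying metric space is isometric to $\mathfrak{U}$, so it is written as $(\mathfrak{U},d,P)$. Unstable grey sets: let $Y\subseteq\mathfrak{U}_L$ be $\mathbf{t}$-closed and $\mathrm{Iso}(\mathfrak{U})$-invariant, $\phi(\bar x,\bar x')\in\mathcal{L}$ and $\bar s,\bar s'$ tuples from $\mathbb{Q}\mathfrak{U}$ of the corresponding lengths. $\phi(\bar s,\bar s')$ is unstable with respect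 to $Y$ if there are rationals $r_1<r_2$ in $[0,1]$ such that for every $n$ and every rational $\varepsilon\in(0,1]$ there are tuples $\bar s_1,\bar s'_1,\dots,\bar s_n,\bar s'_n$ from $\mathbb{Q}\mathfrak{U}$ with $d(\mathrm{tp}^{\mathfrak{U}}(\bar s_i\bar s'_j),\mathrm{tp}^{\mathfrak{U}}(\bar s\bar s'))\le\varepsilon$ for all $i,j\le n$ (types over $\emptyset$ in the language $\langle d\rangle$, distance computed for $Th(\mathfrak{U})$) and there is $A\in Y$ with $\phi^A(\bar s_i,\bar s'_j)\dot{-}r_1\le\varepsilon$ for all $i<j$ and $r_2\dot{-}\phi^A(\bar s_i,\bar s'_j)\le\varepsilon$ for all $j\le i$. $Y$ is relatively stable if no $\phi(\bar s,\bar s')$, with $\phi\in\mathcal{L}$ and $\bar s,\bar s'$ from $\mathbb{Q}\mathfrak{U}$, is unstable with respect to $Y$. *)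

(* Defs.v *)
From HB Require Import structures.
From mathcomp Require Import all_boot all_order all_algebra.
From mathcomp Require Import all_classical all_reals all_analysis.
Set Implicit Arguments.
Unset Strict Implicit.
Unset Printing Implicit Defensive.
Import Order.TTheory GRing.Theory Num.Theory.
Local Open Scope classical_set_scope.
Local Open Scope ring_scope.

(** ** Metric spaces *)

Definition diam_le1 (R : realType) (X : metricType R) : Prop :=
  forall x y : X, mdist x y <= 1.

Definition complete_space (R : realType) (X : metricType R) : Prop :=
  forall F : set_system X, ProperFilter F -> cauchy F -> exists x : X, F --> x.

Definition separable (X : topologicalType) : Prop :=
  exists2 D : set X, countable D & dense D.

Definition rational_distances (R : realType) (X : metricType R) : Prop :=
  forall x y : X, exists q : rat, mdist x y = ratr q.

Definition isometric (R : realType) (X Y : metricType R) (f : X -> Y) : Prop :=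
  forall x y, mdist (f x) (f y) = mdist x y.

Definition isometries (R : realType) (X : metricType R) : set (X -> X) :=
  [set g | isometric g /\ bijective g].

Definition ultrahomogeneous (R : realType) (X : metricType R) : Prop :=
  forall (F : set X) (f : X -> X), finite_set F ->
    {in F &, forall x y, mdist (f x) (f y) = mdist x y} ->
    exists2 g : X -> X, isometries g & {in F, g =1 f}.

Definition urysohn (R : realType) (U : metricType R) : Prop :=
  [/\ complete_space U /\ separable U,
      diam_le1 U /\ sup [set mdist p.1 p.2 | p in [set: U * U]] = 1,
      ultrahomogeneous U
    & forall X : metricType R, separable X -> diam_le1 X ->
        exists f : X -> U, isometric f].

Definition rational_urysohn (R : realType) (Q : metricType R) : Prop :=
  [/\ countable [set: Q],
      diam_le1 Q /\ rational_distances Q,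
      ultrahomogeneous Q
    & forall X : metricType R, countable [set: X] -> diam_le1 X ->
        rational_distances X -> exists f : X -> Q, isometric f].

Definition standard_embedding (R : realType) (Q U : metricType R) (iota : Q -> U) :
    Prop :=
  [/\ isometric iota,
      dense (range iota),
      forall f : Q -> Q, isometries f ->
        exists2 g : U -> U, isometries g & g \o iota = iota \o f
    & @isometries R U `<=`
        closure [set g : {ptws U -> U} | isometries (g : U -> U) /\
                 exists2 f : Q -> Q, isometries f & g \o iota = iota \o f]].

(** ** Continuous logic *)

(* A signature consists of the metric and of unary predicate symbols, all with
   continuity modulus [id], indexed by a type [S]: the signature <d> is
   [S := void] and the signature (d, P) is [S := unit]. *)

Record prestructure (R : realType) (S : Type) := Prestructure {
  carrier :> metricType R;
  interp : S -> carrier -> R }.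

Definition predicate_on (R : realType) (X : metricType R) (P : X -> R) : Prop :=
  (forall x, 0 <= P x <= 1) /\ (forall x y, `|P x - P y| <= mdist x y).

Definition is_structure (R : realType) (S : Type) (N : prestructure R S) :
    Prop :=
  [/\ [set: N] !=set0, complete_space N, diam_le1 N
    & forall a : S, predicate_on (@interp R S N a)].

Definition embedding (R : realType) (S : Type) (M N : prestructure R S)
    (f : M -> N) : Prop :=
  isometric f /\ forall a x, interp a (f x) = interp a x.

Definition isomorphic (R : realType) (S : Type) (M N : prestructure R S) :
    Prop :=
  exists f : M -> N, embedding f /\ bijective f.

(* Formulas whose free variables are among n variables, indexed by ['I_n]. A
   quantifier binds the variable 0 of its body, and shifts the others by 1. *)
Inductive formula (S : Type) (n : nat) : Type :=
| FDist of 'I_n & 'I_n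
| FPred of S & 'I_n
| FCompl of formula S n
| FHalf of formula S n
| FMonus of formula S n & formula S n
| FMin of formula S n & formula S n
| FMax of formula S n & formula S n
| FScale of {posnum rat} & formula S n
| FSup of formula S n.+1
| FInf of formula S n.+1.

Definition monus (R : realType) (x y : R) : R := Num.max (x - y) 0.

Fixpoint feval (R : realType) (S : Type) (N : prestructure R S) (n : nat)
    (phi : formula S n) (v : n.-tuple N) {struct phi} : R :=
  match phi with
  | FDist i j => mdist (tnth v i) (tnth v j)
  | FPred a i => interp a (tnth v i)
  | FCompl phi => 1 - feval phi v
  | FHalf phi => feval phi v / 2
  | FMonus phi psi => monus (feval phi v) (feval psi v)
  | FMin phi psi => Num.min (feval phi v) (feval psi v)
  | FMax phi psi => Num.max (feval phi v) (feval psi v)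
  | FScale q phi => Num.min 1 (ratr q%:num * feval phi v)
  | FSup phi => sup [set feval phi [tuple of x :: v] | x in [set: N]]
  | FInf phi => inf [set feval phi [tuple of x :: v] | x in [set: N]]
  end.

(* A set of formulas stands for the set of conditions [phi = 0]. *)

Definition theory (R : realType) (S : Type) (N : prestructure R S) :
    set (formula S 0) :=
  [set phi | feval phi ([tuple] : 0.-tuple N) = 0].

Definition model (R : realType) (S : Type) (T : set (formula S 0))
    (N : prestructure R S) : Prop :=
  is_structure N /\ T `<=` theory N.

Definition separably_categorical (R : realType) (S : Type)
    (T : set (formula S 0)) : Prop :=
  exists N : prestructure R S,
    [/\ model T N, separable N
      & forall N' : prestructure R S,
          model T N' -> separable N' -> isomorphic N N'].

Definition tp (R : realType) (S : Type) (N : prestructure R S) (n : nat)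
    (c : n.-tuple N) : set (formula S n) :=
  [set phi | feval phi c = 0].

Definition realizes (R : realType) (S : Type) (N : prestructure R S) (n : nat)
    (c : n.-tuple N) (p : set (formula S n)) : Prop :=
  p `<=` tp c.

Definition tuple_dist (R : realType) (X : metricType R) (n : nat)
    (c b : n.-tuple X) : R :=
  \big[Num.max/0]_(i < n) mdist (tnth c i) (tnth b i).

(* The set is nonempty whenever p and q are complete types of a complete theory
   T, so that the value [inf set0 = 0] plays no role. *)
Definition type_dist (R : realType) (S : Type) (T : set (formula S 0)) (n : nat)
    (p q : set (formula S n)) : R :=
  inf [set r : R | exists (N : prestructure R S) (c b : n.-tuple N),
         [/\ model T N, realizes c p, realizes b q & r = tuple_dist c b]].

(** ** The class K and its limit *)

Definition pure_metric (R : realType) (X : metricType R) :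
    prestructure R void := @Prestructure R void X (fun a _ => of_void R a).

Definition dist_to (R : realType) (X : metricType R) (B : set X) (x : X) : R :=
  inf [set mdist x b | b in B].

(* The inclusion of A into B is given by an isometric map e. *)
Definition classK (R : realType) (A : prestructure R unit) : Prop :=
  finite_set [set: A] /\
  exists (B : metricType R) (e : A -> B) (B0 : set B),
    [/\ isometric e, diam_le1 B, B0 !=set0
      & forall x : A, interp tt x = dist_to B0 (e x)].

(* Finite substructures, and inclusions of structures of K, are considered up to
   isomorphism, as embeddings. *)
Definition fraisse_limit (R : realType) (K : prestructure R unit -> Prop)
    (M : prestructure R unit) : Prop :=
  [/\ is_structure M, separable M,
      forall (A : prestructure R unit) (f : A -> M),
        finite_set [set: A] -> embedding f -> K A
    & forall (A A' : prestructure R unit) (i : A -> A') (f : A -> M) (eps : R),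
        K A -> K A' -> embedding i -> embedding f -> 0 < eps ->
        exists2 g : A' -> M, embedding g &
          forall a, mdist (g (i a)) (f a) <= eps].

(** ** The space of structures on a metric space *)

Record lstruct (R : realType) (U : metricType R) := Lstruct {
  lpred :> U -> R;
  lpredP : predicate_on lpred }.

Definition with_pred (R : realType) (U : metricType R) (A : lstruct U) :
    prestructure R unit := @Prestructure R unit U (fun _ => lpred A).

HB.instance Definition _ (R : realType) (U : metricType R) :=
  gen_eqMixin (lstruct U).
HB.instance Definition _ (R : realType) (U : metricType R) :=
  gen_choiceMixin (lstruct U).

Definition tuple_in (X : Type) (D : set X) (n : nat) : set (n.-tuple X) :=
  [set s | forall i, D (tnth s i)].

(* [lspace D] is the space of structures on U with the topology t, where D is
   the set of points allowed as values of the variables. *)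
Definition lspace (R : realType) (U : metricType R) (D : set U) : Type :=
  lstruct U.

Definition t_basis (R : realType) (U : metricType R) (D : set U) :
    set (set (lspace D)) :=
  [set B | exists (n : nat) (phi : formula unit n) (s : n.-tuple U) (r : rat),
     [/\ tuple_in D s, 0 < r < 1
       & B = [set A : lstruct U | @feval R unit (with_pred A) n phi s < ratr r]]].

Definition lift_var (n m : nat) (f : 'I_n -> 'I_m) (i : 'I_n.+1) : 'I_m.+1 :=
  if unlift ord0 i is Some j then lift ord0 (f j) else ord0.

Fixpoint rename (S : Type) (n m : nat) (f : 'I_n -> 'I_m) (phi : formula S n) :
    formula S m :=
  match phi with
  | FDist i j => FDist S (f i) (f j)
  | FPred a i => FPred a (f i)
  | FCompl phi => FCompl (rename f phi)
  | FHalf phi => FHalf (rename f phi)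
  | FMonus phi psi => FMonus (rename f phi) (rename f psi)
  | FMin phi psi => FMin (rename f phi) (rename f psi)
  | FMax phi psi => FMax (rename f phi) (rename f psi)
  | FScale q phi => FScale q (rename f phi)
  | FSup phi => FSup (rename (lift_var f) phi)
  | FInf phi => FInf (rename (lift_var f) phi)
  end.

Lemma eval_rename (R : realType) (S : Type) (N : prestructure R S) (n m : nat)
    (f : 'I_n -> 'I_m) (phi : formula S n) (v : m.-tuple N) :
  feval (rename f phi) v = feval phi [tuple tnth v (f i) | i < n].
Proof.
have cons_lift k l (h : 'I_k -> 'I_l) (w : l.-tuple N) (x : N) :
    [tuple tnth [tuple of x :: w] (lift_var h i) | i < k.+1] =
    [tuple of x :: [tuple tnth w (h i) | i < k]].
  apply: eq_from_tnth => i; rewrite tnth_mktuple /lift_var.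
  by case: (unliftP ord0 i) => [j|] ->; rewrite ?tnthS ?tnth_mktuple ?tnth0.
elim: phi m f v => /=.
- by move=> k i j l h w; rewrite !tnth_mktuple.
- by move=> k a i l h w; rewrite tnth_mktuple.
- by move=> k p IHp l h w; rewrite IHp.
- by move=> k p IHp l h w; rewrite IHp.
- by move=> k p IHp q IHq l h w; rewrite IHp IHq.
- by move=> k p IHp q IHq l h w; rewrite IHp IHq.
- by move=> k p IHp q IHq l h w; rewrite IHp IHq.
- by move=> k r p IHp l h w; rewrite IHp.
- move=> k p IHp l h w; congr (sup _); apply: eq_imagel => x _.
  by rewrite IHp cons_lift.
- move=> k p IHp l h w; congr (inf _); apply: eq_imagel => x _.
  by rewrite IHp cons_lift.
Qed.

Lemma t_basis_cover (R : realType) (U : metricType R) (D : set U) :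
  \bigcup_(B in @t_basis R U D) B = setT.
Proof.
apply/seteqP; split=> // A _.
exists [set A : lstruct U | @feval R unit (with_pred A) 0
   (FSup (FDist unit ord0 ord0)) [tuple] < ratr (1 / 2)].
  by exists 0%N, (FSup (FDist unit ord0 ord0)), [tuple], (1 / 2); split => // -[].
have h0 : (0 : R) < ratr (1 / 2) by rewrite ltr0q.
suff supE : sup (range (fun x : U => mdist x x)) = 0.
  by rewrite /= -supE in h0 *.
have -> : range (fun x : U => mdist x x) = range ((fun=> 0) : U -> R).
  by apply: eq_imagel => x _; exact: mdistxx.
have [[x0 _]|n0] := pselect ([set: U] !=set0).
  rewrite (_ : range _ = [set 0]) ?sup1 //.
  by apply/seteqP; split => [_ [x _ <-] //|_ ->]; exists x0.
rewrite (_ : range _ = set0) ?sup0 //.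
by apply/seteqP; split => // y [x _ _]; case: n0; exists x.
Qed.

Lemma t_basis_join (R : realType) (U : metricType R) (D : set U)
    (B C : set (lspace D)) (A : lspace D) :
  t_basis B -> t_basis C -> B A -> C A ->
  exists E, [/\ t_basis E, E A & E `<=` B `&` C].
Proof.
move=> [n [p [s [r [Ds /andP[r0 r1] ->]]]]].
move=> [m [q [s' [r' [Ds' /andP[r'0 r'1] ->]]]]] pA qA.
pose pq := FMax (FScale (PosNum r'0) (rename (lshift m) p))
                (FScale (PosNum r0) (rename (@rshift n m) q)).
have rr0 : 0 < r * r' by rewrite mulr_gt0.
have rr1 : r * r' < 1 by rewrite mulr_ilt1 // ltW.
have evalE (X : lstruct U) :
    (@feval R unit (with_pred X) _ pq [tuple of s ++ s'] < ratr (r * r')) =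
    (@feval R unit (with_pred X) _ p s < ratr r) &&
    (@feval R unit (with_pred X) _ q s' < ratr r').
  have cutE (a b : rat) (y : R) : 0 < a -> a * b < 1 ->
      (Num.min 1 (ratr a * y) < ratr (a * b)) = (y < ratr b).
    move=> a0 ab; rewrite gt_min [ratr (a * b)]rmorphM /=.
    rewrite ltr_pM2l ?ltr0q // ltNge ltW //.
    by rewrite -rmorphM /= -(rmorph1 (ratr : rat -> R)) ltr_rat.
  have evl : @feval R unit (with_pred X) _ (rename (lshift m) p) [tuple of s ++ s'] =
             @feval R unit (with_pred X) _ p s.
    rewrite eval_rename; congr feval; apply: eq_from_tnth => i.
    by rewrite tnth_mktuple tnth_lshift.
  have evr : @feval R unit (with_pred X) _ (rename (@rshift n m) q) [tuple of s ++ s'] =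
             @feval R unit (with_pred X) _ q s'.
    rewrite eval_rename; congr feval; apply: eq_from_tnth => i.
    by rewrite tnth_mktuple tnth_rshift.
  rewrite /pq /= gt_max evl evr; congr andb; last exact: cutE.
  by rewrite [r * r']mulrC cutE // mulrC.
exists [set X : lstruct U | @feval R unit (with_pred X) _ pq [tuple of s ++ s']
          < ratr (r * r')]; split.
- exists (n + m)%N, pq, [tuple of s ++ s'], (r * r'); split; last by [].
    by move=> i; case: (split_ordP i) => j ->; rewrite ?tnth_lshift ?tnth_rshift.
  by rewrite rr0.
- by rewrite /= evalE; apply/andP.
- by move=> X /=; rewrite evalE => /andP.
Qed.

HB.instance Definition _ (R : realType) (U : metricType R) (D : set U) :=
  Choice.on (lspace D).
HB.instance Definition _ (R : realType) (U : metricType R) (D : set U) :=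
  @isBaseTopological.Build (lspace D) (set (lspace D)) (@t_basis R U D) id
    (@t_basis_cover R U D) (@t_basis_join R U D).

Definition iso_invariant (R : realType) (U : metricType R)
    (Y : set (lstruct U)) : Prop :=
  forall (g : U -> U) (A B : lstruct U),
    isometries g -> (forall x, B (g x) = A x) -> Y A -> Y B.

(** ** Unstable grey sets *)

Definition unstable (R : realType) (U : metricType R) (D : set U)
    (Y : set (lstruct U)) (m k : nat) (phi : formula unit (m + k))
    (s : m.-tuple U) (s' : k.-tuple U) : Prop :=
  exists r1 r2 : rat,
    [/\ 0 <= r1, r1 < r2, r2 <= 1
      & forall (n : nat) (eps : rat), 0 < eps <= 1 ->
        exists (t : 'I_n -> m.-tuple U) (t' : 'I_n -> k.-tuple U),
        [/\ forall i, tuple_in D (t i) /\ tuple_in D (t' i),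
            forall i j : 'I_n,
              type_dist R (theory (pure_metric U))
                (@tp R void (pure_metric U) (m + k) [tuple of t i ++ t' j])
                (@tp R void (pure_metric U) (m + k) [tuple of s ++ s'])
              <= ratr eps
          & exists2 A : lstruct U, Y A &
              forall i j : 'I_n,
                let a := @feval R unit (with_pred A) (m + k) phi
                           [tuple of t i ++ t' j] in
                ((i < j)%N -> monus a (ratr r1) <= ratr eps) /\
                ((j <= i)%N -> monus (ratr r2) a <= ratr eps)]].

Definition relatively_stable (R : realType) (U : metricType R) (D : set U)
    (Y : set (lstruct U)) : Prop :=
  forall (m k : nat) (phi : formula unit (m + k))
    (s : m.-tuple U) (s' : k.-tuple U),
    tuple_in D s -> tuple_in D s' -> ~ unstable D Y phi s s'.

Definition models_on (R : realType) (U : metricType R)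
    (T : set (formula unit 0)) : set (lstruct U) :=
  [set A | model T (with_pred A)].

(* Main.v *)
(** K consists of all finite structures with a 1-Lipschitz predicate, because P
    is the distance to X * {0} on the graph of P inside X * R. Hence in the
    Fraisse limit every almost consistent prescription of distances to a finite
    tuple and of a value of P, with defect D, is realized up to any error above
    D. This is a scheme of conditions, so it holds in all models of Th(M). In
    complete structures it yields exact one-point extensions, and a
    back-and-forth gives categoricity. It also shows by induction on formulas
    that the value of a formula is determined, with a uniform modulus, by the
    distances and the values of P on its arguments. In an unstable array all
    distances are nearly constant, and by the pigeonhole principle two indices
    i < j have nearly the same values of P; then phi(s_i, s'_j) and
    phi(s_j, s'_i) are too close to each other. *)

Require Import Defs.
From HB Require Import structures.
From mathcomp Require Import all_boot all_order all_algebra.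
From mathcomp Require Import all_classical all_reals all_analysis.
From mathcomp Require Import lra.
Set Implicit Arguments.
Unset Strict Implicit.
Unset Printing Implicit Defensive.
Import Order.TTheory GRing.Theory Num.Theory.
Local Open Scope classical_set_scope.
Local Open Scope ring_scope.

(** * Constructions of metric spaces *)

(** A metric as plain data: its axioms may come from local hypotheses, so spaces can be built inside
    a proof; [md_space] carries the resulting instance. *)
Record metric_data (R : realType) := MetricData {
  md_point : choiceType;
  md_dist : md_point -> md_point -> R;
  md_dist0 : forall x, md_dist x x = 0;
  md_dist_eq : forall x y, md_dist x y = 0 -> x = y;
  md_dist_sym : forall x y, md_dist x y = md_dist y x;
  md_dist_tri : forall y x z, md_dist x z <= md_dist x y + md_dist y z }.

Definition md_space (R : realType) (m : metric_data R) : Type := md_point m.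

HB.instance Definition _ (R : realType) (m : metric_data R) :=
  Choice.on (md_space m).
HB.instance Definition _ (R : realType) (m : metric_data R) :=
  @isMetric.Build R (md_space m) (@md_dist R m) (@md_dist0 R m)
    (@md_dist_eq R m) (@md_dist_sym R m) (@md_dist_tri R m).

Section Constructions.
Context {R : realType}.
Implicit Types X Y : metricType R.

(** Serves to view the range of a tuple, possibly with repetitions, as a metric space of its own. *)
Lemma subspaceP X (A : set X) : exists (Y : metricType R) (e : Y -> X),
  isometric e /\ range e = A.
Proof.
have d0 (x : A) : mdist (val x) (val x) = 0 :> R by exact: mdistxx.
have de (x y : A) : mdist (val x) (val y) = 0 :> R -> x = y.
  by move=> /mdist_positivity xy; exact: val_inj.
have ds (x y : A) : mdist (val x) (val y) = mdist (val y) (val x) :> R.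
  exact: metric_sym.
have dt (y x z : A) : mdist (val x) (val z) <=
    mdist (val x) (val y) + mdist (val y) (val z) :> R.
  exact: metric_triangle.
exists (md_space (MetricData d0 de ds dt)), (fun x : A => val x).
split=> //; apply/seteqP; split => [_ [x _ <-]|x Ax]; first exact: set_valP.
by exists (SigSub (mem_set Ax)).
Qed.

Definition one_point_dist X (g : X -> R) (x y : option X) : R :=
  match x, y with
  | Some x, Some y => mdist x y
  | Some x, None | None, Some x => g x
  | None, None => 0
  end.

(** The hypotheses make [g] a Katetov function, and strict positivity keeps the new point apart from
    the old ones. The injection [t] shows that [Y] has no further points and lets functions on [Y]
    be defined by cases. *)
Lemma one_pointP X (g : X -> R) :
  (forall x, 0 < g x) -> (forall x y, g x <= g y + mdist x y) ->
  (forall x y, mdist x y <= g x + g y) ->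
  exists (Y : metricType R) (e : X -> Y) (c : Y),
    [/\ isometric e, forall x, mdist c (e x) = g x &
      exists t : Y -> option X,
        [/\ injective t, t c = None & forall x, t (e x) = Some x]].
Proof.
move=> g0 gL gT.
have d0 x : one_point_dist g x x = 0 by case: x => //= x; exact: mdistxx.
have de x y : one_point_dist g x y = 0 -> x = y.
  case: x y => [x|] [y|] //= => [/mdist_positivity->//|gx|gy].
    by have := g0 x; rewrite gx ltxx.
  by have := g0 y; rewrite gy ltxx.
have ds x y : one_point_dist g x y = one_point_dist g y x.
  by case: x y => [x|] [y|] //=; exact: metric_sym.
have dt y x z : one_point_dist g x z <= one_point_dist g x y + one_point_dist g y z.
  case: x y z => [x|] [y|] [z|] //=; rewrite ?addr0 ?add0r //.
  - exact: metric_triangle.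
  - by rewrite addrC.
  - by rewrite metric_sym.
  - by rewrite addr_ge0 // ltW.
pose m := MetricData d0 de ds dt.
exists (md_space m), (Some : X -> md_space m), (None : md_space m).
by split => //; exists id; split.
Qed.

(** The distance on the real line is capped at 1 so that the product inherits the bound 1 on the
    diameter. *)
Lemma max_productP X : exists (Y : metricType R) (pair : X -> R -> Y),
  (forall x y s t, mdist (pair x s) (pair y t) =
     Num.max (mdist x y) (Num.min 1 `|s - t|)) /\
  (forall z : Y, exists x s, z = pair x s).
Proof.
pose d (x y : X * R) : R := Num.max (mdist x.1 y.1) (Num.min 1 `|x.2 - y.2|).
have d0 x : d x x = 0.
  by rewrite /d mdistxx subrr normr0 min_r ?ler01// maxxx.
have de x y : d x y = 0 -> x = y.
  case: x y => [x s] [y t]; rewrite /d /= => dxy.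
  have : mdist x y <= 0 by rewrite -dxy le_max lexx.
  have : Num.min 1 `|s - t| <= 0 by rewrite -dxy le_max lexx orbT.
  rewrite ge_min ler10 /= normr_le0 subr_eq0 => /eqP -> xy0.
  congr pair; apply/mdist_positivity/eqP.
  by rewrite eq_le xy0 mdist_ge0.
have ds x y : d x y = d y x by rewrite /d metric_sym distrC.
have dt y x z : d x z <= d x y + d y z.
  rewrite {1}/d ge_max; apply/andP; split.
    rewrite (le_trans (metric_triangle _ y.1 _)) // lerD //.
      by rewrite /d le_max lexx.
    by rewrite /d le_max lexx.
  have xy : Num.min 1 `|x.2 - y.2| <= d x y by rewrite /d le_max lexx orbT.
  have yz : Num.min 1 `|y.2 - z.2| <= d y z by rewrite /d le_max lexx orbT.
  rewrite (le_trans _ (lerD xy yz)) //.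
  have tr : `|x.2 - z.2| <= `|x.2 - y.2| + `|y.2 - z.2|.
    by rewrite (le_trans _ (ler_normD _ _)) // addrA subrK.
  have := normr_ge0 (x.2 - y.2); have := normr_ge0 (y.2 - z.2).
  rewrite /Num.min; case: ifP => ?; case: ifP => ?; case: ifP => ?; lra.
pose m := MetricData d0 de ds dt.
exists (md_space m), (fun x s => (x, s) : md_space m); split => // -[x s].
by exists x, s.
Qed.

(* A 1-Lipschitz function P on X is the distance to X * {0} at the point
   (x, P x) of X * R, for the max distance. *)
Lemma classK_of_predicate X (Q : X -> R) (A : prestructure R unit) (e : A -> X) :
  [set: X] !=set0 -> diam_le1 X -> predicate_on Q -> finite_set [set: A] ->
  isometric e -> (forall a, interp tt a = Q (e a)) -> classK A.
Proof.
move=> [x0 _] X1 [Q01 QL] Afin eI AQ; split => //.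
have [Y [pr [prd prs]]] := max_productP X.
exists Y, (fun a => pr (e a) (Q (e a))), (range (pr^~ 0)); split.
- move=> a b; rewrite prd eI; apply/max_idPl.
  by rewrite ge_min -eI QL orbT.
- move=> y z; have [x [s ->]] := prs y; have [x' [s' ->]] := prs z.
  by rewrite prd ge_max X1 ge_min lexx.
- by exists (pr x0 0); exists x0.
- move=> a; rewrite AQ /dist_to; have /andP[Q0 Q1] := Q01 (e a).
  have mE : Num.min 1 `|Q (e a) - 0| = Q (e a).
    by rewrite subr0 ger0_norm // min_r.
  apply/eqP; rewrite eq_le; apply/andP; split.
    apply: lb_le_inf; first by
      exists (mdist (pr (e a) (Q (e a))) (pr (e a) 0)), (pr (e a) 0) => //;
      exists (e a).
    move=> _ [_ [x _ <-] <-]; rewrite prd mE le_max lexx orbT //.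
  apply: ge_inf.
    by exists 0 => _ [b _ <-]; exact: mdist_ge0.
  exists (pr (e a) 0); first by exists (e a).
  by rewrite prd mE mdistxx; apply/max_idPr.
Qed.

End Constructions.

(** * One-point extensions in the limit *)

Section Extension.
Context {R : realType}.
Implicit Types N : prestructure R unit.

(* h and p prescribe the distances to v and the value of P at a new point; D is
   the defect of this prescription. *)
Definition almost_type N n (v : 'I_n -> N) (h : 'I_n -> R) (p D : R) : Prop :=
  [/\ (forall i, 0 <= h i <= 1) /\ 0 <= p <= 1,
      forall i j, h i <= h j + mdist (v i) (v j) + D,
      forall i j, mdist (v i) (v j) <= h i + h j + D
    & forall i, `|p - interp tt (v i)| <= h i + D].

Definition almost_realizes N n (v : 'I_n -> N) (h : 'I_n -> R) (p e : R) (y : N) :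
    Prop :=
  (forall i, `|mdist y (v i) - h i| <= e) /\ `|interp tt y - p| <= e.

(** Since the defect [D] is part of the error, one property covers exact prescriptions, used in the
    back-and-forth, and approximate ones, used for formulas. *)
Definition ext_property N : Prop :=
  forall n (v : 'I_n -> N) (h : 'I_n -> R) (p D eps : R),
    0 <= D -> 0 < eps -> almost_type v h p D ->
    exists y, almost_realizes v h p (D + eps) y.

Lemma bigmin1P n (F : 'I_n -> R) (m := \big[Num.min/1]_(i < n) F i) :
  [/\ m <= 1, forall i, m <= F i & m = 1 \/ exists i, m = F i].
Proof.
split; first exact: bigmin_le_id.
  by move=> i; exact: bigmin_le.
rewrite /m; apply: (big_ind (fun x => x = 1 \/ exists i, x = F i)).
- by left.
- by move=> x y Hx Hy; rewrite /Num.min; case: ifP.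
- by move=> i _; right; exists i.
Qed.

(** The prescription is corrected to a Katetov function [g] that also dominates $|p - P|$. A point
    at distances [g] with value [p] can then be added to the range of [v] inside the class, and the
    enlarged structure embeds into the limit. *)
Lemma fraisse_limit_ext N : fraisse_limit (@classK R) N -> ext_property N.
Proof.
move=> [[[x0 _] _ N1 PN] _ _ NE] n v h p D eps D0 e0 [[h01 p01] hL hT hP].
have [P01 PL] := PN tt.
(* One [eta] makes [g] strictly positive, the other pays for the inexact position of the embedded
   tuple. *)
pose eta := eps / 2; have eta0 : 0 < eta by rewrite divr_gt0.
pose F x i := h i + D + eta + mdist x (v i).
pose g x := \big[Num.min/1]_(i < n) F x i.
have gP x := bigmin1P (F x).
have F0 x i : 0 < F x i.
  by have := h01 i; have := mdist_ge0 x (v i); rewrite /F; lra.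
have g0 x : 0 < g x by have [_ _ [|[i]]] := gP x; rewrite -/(g x) => ->.
have g1 x : g x <= 1 by have [] := gP x.
have gL x y : g x <= g y + mdist x y.
  have [_ _ [|[i]]] := gP y; rewrite -/(g y) => ->.
    by rewrite (le_trans (g1 x)) // lerDl mdist_ge0.
  have [_ /(_ i) + _] := gP x; rewrite -/(g x) /F.
  by have := metric_triangle x y (v i); lra.
have gT x y : mdist x y <= g x + g y.
  have [_ _ [|[i]]] := gP x; rewrite -/(g x) => ->.
    by have := N1 x y; have := g0 y; lra.
  have [_ _ [|[j]]] := gP y; rewrite -/(g y) => ->.
    by have := N1 x y; have := F0 x i; lra.
  have := hT i j; have := metric_triangle x (v i) y.
  have := metric_triangle (v i) (v j) y; rewrite (metric_sym (v j) y) /F; lra.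
have gp x : `|p - interp tt x| <= g x.
  have [_ _ [|[i]]] := gP x; rewrite -/(g x) => ->.
    have /andP[p0 p1] := p01; have /andP[q0 q1] := P01 x.
    by rewrite ler_norml; lra.
  rewrite -(subrK (interp tt (v i)) p) -addrA (le_trans (ler_normD _ _)) //.
  rewrite /F (le_trans (lerD (hP i) (PL (v i) x))) // (metric_sym x); lra.
(* The term of index [i] bounds [g] from above at [v i]; the approximate Lipschitz condition [hL]
   bounds it from below. *)
have gv i : h i <= g (v i) <= h i + D + eta.
  have [_ /(_ i) gi gE] := gP (v i); rewrite -/(g _) /F mdistxx addr0 in gi gE *.
  rewrite gi andbT.
  case: gE => [->|[j ->]]; first by have /andP[] := h01 i.
  have := hL i j; lra.
have [Y [e [eI eV]]] := subspaceP (range v).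
have geL x y : (g \o e) x <= (g \o e) y + mdist x y by rewrite -eI; exact: gL.
have geT x y : mdist x y <= (g \o e) x + (g \o e) y by rewrite -eI; exact: gT.
have [Z [e' [c [e'I ce [t [ti tc te]]]]]] :=
  @one_pointP _ Y (g \o e) (fun y => g0 (e y))
  geL geT.
(* The predicate is extended by the value [p] at the new point; by [gp] the extension is
   1-Lipschitz. *)
pose Q z := if t z is Some y then interp tt (e y) else p.
pose A := @Prestructure R unit Y (fun=> interp tt \o e).
pose A' := @Prestructure R unit Z (fun=> Q).
have tE z : z = c \/ exists y, z = e' y.
  case E: (t z) => [y|]; [right; exists y|left]; apply: ti; by rewrite E ?te ?tc.
have Qc : Q c = p by rewrite /Q tc.
have Qe y : Q (e' y) = interp tt (e y) by rewrite /Q te.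
have Z1 : diam_le1 Z.
  move=> x y; case: (tE x) => [->|[x' ->]]; case: (tE y) => [->|[y' ->]].
  - by rewrite mdistxx.
  - by rewrite ce /=.
  - by rewrite metric_sym ce /=.
  - by rewrite e'I -eI.
have QP : predicate_on Q.
  split; first by move=> z; case: (tE z) => [->|[y ->]]; rewrite ?Qc ?Qe.
  move=> x y; case: (tE x) => [->|[x' ->]]; case: (tE y) => [->|[y' ->]].
  - by rewrite subrr normr0 mdistxx.
  - by rewrite Qc Qe ce.
  - by rewrite Qc Qe distrC metric_sym ce.
  - by rewrite !Qe e'I -eI.
have Yfin : finite_set [set: Y].
  have vfin : finite_set (range v) by exact: finite_image.
  rewrite -eV in vfin.
  have einj x y : e x = e y -> x = y.
    by move=> exy; apply: mdist_positivity; rewrite -eI exy mdistxx.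
  rewrite (_ : setT = e @^-1` (range e)); last first.
    by apply/seteqP; split => // y _; exists y.
  by apply: finite_preimage => // x y _ _; exact: einj.
have Zfin : finite_set [set: Z].
  apply: (@sub_finite_set _ _ ([set c] `|` e' @` setT)).
    by move=> z _; case: (tE z) => [->|[y ->]]; [left|right; exists y].
  by rewrite finite_setU; split; [exact: finite_set1|exact: finite_image].
have KA : classK A.
  apply: (@classK_of_predicate R N (interp tt) A e) => //.
  by exists x0.
have KA' : classK A'.
  apply: (@classK_of_predicate R Z Q A' id) => //.
  by exists c.
have iE : embedding (e' : A -> A') by split => // -[] x /=; rewrite Qe.
have fE : embedding (e : A -> N) by split => // -[].
have [f [fI fP] fe] := NE A A' e' e eta KA KA' iE fE eta0.
exists (f c); split.
  move=> i; have [y _ ey] : range e (v i) by rewrite eV; exists i.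
  have := fe y; rewrite ey => fy.
  have := metric_triangle (f c) (f (e' y)) (v i).
  have := metric_triangle (f c) (v i) (f (e' y)).
  rewrite fI ce /= ey (metric_sym (v i)) => t1 t2.
  have /andP[gi1 gi2] := gv i.
  have ee : eps = eta + eta by rewrite /eta -splitr.
  by rewrite ler_norml; lra.
rewrite (fP tt c) /= Qc subrr normr0; lra.
Qed.

End Extension.

(** * The extension scheme as a set of conditions *)

Section Formulas.
Context {R : realType} {S : Type}.
Implicit Types N : prestructure R S.

Lemma monus_le (x y r : R) : 0 <= r -> (monus x y <= r) = (x <= y + r).
Proof. by move=> r0; rewrite /monus ge_max r0 andbT lerBlDl. Qed.

Lemma monus_eq0 (x y : R) : (monus x y == 0) = (x <= y).
Proof.
by rewrite /monus -[RHS]subr_le0; apply/eqP/idP => [/max_idPr|/max_idPr].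
Qed.

Lemma monus_itv (x y : R) : 0 <= x <= 1 -> 0 <= y <= 1 -> 0 <= monus x y <= 1.
Proof.
move=> /andP[_ x1] /andP[y0 _].
by rewrite /monus le_max lexx orbT ge_max ler01 andbT lerBlDl (le_trans x1) ?lerDr.
Qed.

Section UnitRange.
Context (T : Type) (F : T -> R).
Hypotheses (T0 : [set: T] !=set0) (F01 : forall x, 0 <= F x <= 1).

Lemma range_sup_ge x : F x <= sup (range F).
Proof.
apply: ub_le_sup; last by exists x.
by exists 1 => _ [y _ <-]; have /andP[] := F01 y.
Qed.

Lemma range_inf_le x : inf (range F) <= F x.
Proof.
apply: ge_inf; last by exists x.
by exists 0 => _ [y _ <-]; have /andP[] := F01 y.
Qed.

Lemma range_sup_le r : (forall x, F x <= r) -> sup (range F) <= r.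
Proof.
move=> Fr; apply: ge_sup; last by move=> _ [x _ <-].
by have [x _] := T0; exists (F x), x.
Qed.

Lemma range_inf_ge r : (forall x, r <= F x) -> r <= inf (range F).
Proof.
move=> Fr; apply: lb_le_inf; last by move=> _ [x _ <-].
by have [x _] := T0; exists (F x), x.
Qed.

Lemma range_inf_lt r : inf (range F) < r -> exists x, F x < r.
Proof.
move=> Fr; apply/not_existsP => rF.
move: Fr; rewrite ltNge range_inf_ge // => x; rewrite leNgt; exact/negP.
Qed.

Lemma range_sup_itv : 0 <= sup (range F) <= 1.
Proof.
have [x _] := T0; have /andP[Fx _] := F01 x.
rewrite (le_trans Fx (range_sup_ge x)) range_sup_le // => y.
by have /andP[] := F01 y.
Qed.

Lemma range_inf_itv : 0 <= inf (range F) <= 1.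
Proof.
have [x _] := T0; have /andP[_ Fx] := F01 x.
rewrite (le_trans (range_inf_le x) Fx) range_inf_ge // => y.
by have /andP[] := F01 y.
Qed.

End UnitRange.

Lemma feval_itv N n (phi : formula S n) (v : n.-tuple N) :
  is_structure N -> 0 <= feval phi v <= 1.
Proof.
move=> [N0 _ N1 PN]; elim: phi v => {n} /=.
- by move=> n i j v; rewrite mdist_ge0 N1.
- by move=> n a i v; have [] := PN a.
- by move=> n phi IH v; have := IH v; lra.
- by move=> n phi IH v; have := IH v; lra.
- by move=> n phi IH psi IH' v; exact: monus_itv.
- move=> n phi IH psi IH' v; have := IH v; have := IH' v.
  by rewrite /Num.min; case: ifP.
- move=> n phi IH psi IH' v; have := IH v; have := IH' v.
  by rewrite /Num.max; case: ifP.
- move=> n q phi IH v; have /andP[I0 _] := IH v.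
  by rewrite ge_min lexx le_min ler01 mulr_ge0 // ler0q.
- by move=> n phi IH v; exact: range_sup_itv.
- by move=> n phi IH v; exact: range_inf_itv.
Qed.

(** The connectives include no constants: 0 is obtained as $\sup_x d(x,x)$, and the other constants
    by scaling its complement. *)
Definition Fzero n : formula S n := FSup (FDist S ord0 ord0).

Definition Fconst n (q : {posnum rat}) : formula S n := FScale q (FCompl (Fzero n)).

(** Values are nonnegative, so on conditions [phi = 0] a prefix of suprema acts as universal
    closure. *)
Fixpoint Fclose n : formula S n -> formula S 0 :=
  match n with
  | 0 => fun phi => phi
  | n'.+1 => fun phi => Fclose (FSup phi)
  end.

(** The value of [Fconst n q] in every structure; the cap comes from truncated multiplication. *)
Definition unit_rat (q : {posnum rat}) : R := Num.min 1 (ratr q%:num).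

Lemma feval_zero N n (v : n.-tuple N) : is_structure N -> feval (Fzero n) v = 0.
Proof.
move=> [N0 _ _ _] /=; apply/eqP; rewrite eq_le range_sup_le //=; last first.
  by move=> x; rewrite mdistxx.
have [x _] := N0; rewrite -[leLHS](mdistxx x).
apply: (@range_sup_ge _ (fun x : N => mdist x x)) => y.
by rewrite mdistxx lexx ler01.
Qed.

Lemma feval_const N n (v : n.-tuple N) q :
  is_structure N -> feval (Fconst n q) v = unit_rat q.
Proof.
by move=> NS; have := feval_zero v NS; rewrite /= => ->; rewrite subr0 mulr1.
Qed.

Lemma feval_max_le N n (phi psi : formula S n) (v : n.-tuple N) r :
  (feval (FMax phi psi) v <= r) = (feval phi v <= r) && (feval psi v <= r).
Proof. by rewrite /= ge_max. Qed.

Lemma feval_monus N n (phi psi : formula S n) (v : n.-tuple N) :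
  feval (FMonus phi psi) v = monus (feval phi v) (feval psi v).
Proof. by []. Qed.

Lemma feval_bigmax N n m (F : 'I_m -> formula S n) (v : n.-tuple N) r :
  is_structure N -> 0 <= r ->
  feval (\big[@FMax S n/Fzero n]_(i < m) F i) v <= r <->
  forall i, feval (F i) v <= r.
Proof.
move=> NS r0.
have -> : feval (\big[@FMax S n/Fzero n]_(i < m) F i) v =
    \big[Num.max/0]_(i < m) feval (F i) v.
  by apply: (@big_morph _ _ (fun phi => feval phi v) 0 Num.max) => //; exact: feval_zero.
by split => [/bigmax_leP[_ Fr] i|Fr]; [exact: Fr|apply/bigmax_leP; split].
Qed.

Lemma feval_close N n (phi : formula S n) : is_structure N ->
  feval (Fclose phi) ([tuple] : 0.-tuple N) = 0 <->
  forall v : n.-tuple N, feval phi v = 0.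
Proof.
move=> NS; elim: n phi => [|n IH] phi /=.
  by split=> [H v|//]; rewrite tuple0.
have [N0 _ _ _] := NS.
split=> [/IH {IH}H v|H].
  have := H [tuple of behead v]; rewrite /= => {}H.
  have vE : v = [tuple of tnth v ord0 :: [tuple of behead v]].
    by case/tupleP: v H => x v _; apply: val_inj; rewrite /= tnth0.
  apply/eqP; rewrite eq_le; have /andP[-> _] := feval_itv phi v NS.
  rewrite andbT -H {1}vE.
  apply: (@range_sup_ge _ (fun x => feval phi [tuple of x :: behead v])) => y.
  exact: feval_itv.
apply/IH => v /=.
rewrite (_ : range (fun x => feval phi [tuple of x :: v]) = [set 0]) ?sup1 //.
have [x _] := N0.
by apply/seteqP; split => [_ [y _ <-]|_ ->] /=; [exact: H|exists x => //; exact: H].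
Qed.

Lemma unit_rat_itv q : 0 <= unit_rat q <= 1.
Proof. by rewrite /unit_rat ge_min lexx le_min ler01 ler0q /= ltW. Qed.

Lemma unit_rat_approx (x eps : R) : 0 <= x <= 1 -> 0 < eps ->
  exists q, `|unit_rat q - x| <= eps.
Proof.
move=> /andP[x0 x1] e0.
(* The rational is taken above [x], so that it is positive even when [x] is 0. *)
have /rat_in_itvoo[q] : x < x + eps by rewrite ltrDl.
rewrite in_itv /= => /andP[xq qe].
have q0 : 0 < q by rewrite -(ltr0q R) (le_lt_trans x0).
exists (PosNum q0); rewrite /unit_rat /= ler_norml.
by case: (leP 1 (ratr q : R)); lra.
Qed.

End Formulas.

Section ExtensionAxioms.
Context {R : realType}.
Implicit Types N : prestructure R unit.

Section Scheme.
Context {n : nat} (q : 'I_n -> {posnum rat}) (p : {posnum rat}).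
Notation FC m := (@Fconst unit m).
Notation V i j := (FDist unit i j).
Notation BM m n F := (\big[@FMax unit m/@Fzero unit m]_(i < n) F i).

(** Its value is the least [D >= 0] for which the constants [q] and [p] prescribe an almost type
    over the variables. *)
Definition ext_defect : formula unit n :=
  FMax (FMax (BM n n (fun i => BM n n (fun j =>
                FMonus (FMonus (FC n (q i)) (FC n (q j))) (V i j))))
             (BM n n (fun i => BM n n (fun j =>
                FMonus (FMonus (V i j) (FC n (q i))) (FC n (q j))))))
       (BM n n (fun i => FMax (FMonus (FMonus (FC n p) (FPred tt i)) (FC n (q i)))
                              (FMonus (FMonus (FPred tt i) (FC n p)) (FC n (q i))))).

(** Variable 0 is the candidate for the new point; the old tuple is shifted by one. *)
Definition ext_error : formula unit n.+1 :=
  FMax (BM n.+1 n (fun i =>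
          FMax (FMonus (V ord0 (lift ord0 i)) (FC n.+1 (q i)))
               (FMonus (FC n.+1 (q i)) (V ord0 (lift ord0 i)))))
       (FMax (FMonus (FPred tt ord0) (FC n.+1 p))
             (FMonus (FC n.+1 p) (FPred tt ord0))).

(** The implication in [ext_property] becomes a single inequality between error and defect, hence a
    condition; the infimum absorbs the [eps]. *)
Definition ext_axiom : formula unit 0 := Fclose (FMonus (FInf ext_error) ext_defect).

Lemma ext_defectP N (v : n.-tuple N) (D : R) : is_structure N -> 0 <= D ->
  feval ext_defect v <= D <->
  almost_type (tnth v) (fun i => unit_rat (q i)) (unit_rat p) D.
Proof.
move=> NS D0.
have u0 r : 0 <= unit_rat r :> R by have /andP[] := @unit_rat_itv R r.
have bigE (m : nat) (F : 'I_m -> formula unit n) := feval_bigmax F v NS D0.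
have cE r := feval_const v r NS.
have mE (a b c : R) : 0 <= c -> (monus (monus a b) c <= D) = (a <= b + c + D).
  by move=> c0; rewrite !monus_le ?addr_ge0 // addrA.
rewrite !feval_max_le; split.
  move=> /andP[/andP[/bigE H1 /bigE H2] /bigE H3]; split.
  - by split => [i|]; exact: unit_rat_itv.
  - move=> i j; have /bigE/(_ j) := H1 i.
    by rewrite !feval_monus !cE mE ?mdist_ge0 //.
  - move=> i j; have /bigE/(_ j) := H2 i.
    by rewrite !feval_monus !cE mE //; lra.
  - move=> i; have := H3 i.
    rewrite feval_max_le !feval_monus !cE !mE // => /andP[h1 h2].
    by rewrite /= in h1 h2; rewrite ler_norml; lra.
move=> [_ H1 H2 H3]; rewrite -andbA; apply/and3P; split; apply/bigE => i.
- apply/bigE => j; rewrite !feval_monus !cE mE ?mdist_ge0 //.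
- apply/bigE => j; rewrite !feval_monus !cE mE //; have := H2 i j => /=; lra.
- rewrite feval_max_le !feval_monus !cE !mE //.
  have := H3 i; rewrite ler_norml /=; lra.
Qed.

Lemma ext_errorP N (v : n.-tuple N) (y : N) (e : R) : is_structure N -> 0 <= e ->
  feval ext_error [tuple of y :: v] <= e <->
  almost_realizes (tnth v) (fun i => unit_rat (q i)) (unit_rat p) e y.
Proof.
move=> NS e0; pose w := [tuple of y :: v].
have bigE (m : nat) (F : 'I_m -> formula unit n.+1) := feval_bigmax F w NS e0.
have cE r := feval_const w r NS.
have y0 : tnth w ord0 = y by rewrite tnth0.
have yS i : tnth w (lift ord0 i) = tnth v i by rewrite tnthS.
have aE (a b : R) : (monus a b <= e) && (monus b a <= e) = (`|a - b| <= e).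
  by rewrite !monus_le // ler_distl; apply/andP/andP; lra.
rewrite -/w !feval_max_le; split.
  move=> /andP[/bigE H1 H2]; split.
    move=> i; have := H1 i.
    rewrite feval_max_le !feval_monus !cE /= y0 yS aE. by [].
  by move: H2; rewrite !feval_monus cE aE /= y0.
move=> [H1 H2]; apply/andP; split.
  by apply/bigE => i; rewrite feval_max_le !feval_monus !cE /= y0 yS aE.
by rewrite !feval_monus cE aE /= y0.
Qed.

Lemma ext_axiomP N : is_structure N -> theory N ext_axiom <->
  forall v : n.-tuple N,
    feval (FInf ext_error) v <= feval ext_defect v.
Proof.
move=> NS; rewrite /theory /= feval_close //; split => H v.
  by have /eqP := H v; rewrite [feval _ _]/= monus_eq0.
by apply/eqP; rewrite [feval _ _]/= monus_eq0; exact: H.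
Qed.

End Scheme.

Lemma ext_property_axioms N : is_structure N ->
  ext_property N <-> forall n (q : 'I_n -> _) p, theory N (ext_axiom q p).
Proof.
move=> NS; have [N0 _ _ _] := NS.
have F01 n (q : 'I_n -> _) p (v : n.-tuple N) x :
    0 <= feval (ext_error q p) [tuple of x :: v] <= 1 by exact: feval_itv.
split=> [NE n q p|NE n v h p D eps D0 e0 [[h01 p01] hL hT hP]].
  apply/ext_axiomP => // v; apply/ler_addgt0Pl => e e0.
  have /andP[D0 _] := feval_itv (ext_defect q p) v NS.
  have /(NE _ _ _ _ _ _ D0 e0)[y yP] := iffLR (ext_defectP q p v NS D0) (lexx _).
  rewrite (le_trans (range_inf_le (F01 n q p v) y)) //.
  by apply/ext_errorP => //; rewrite addrC // addr_ge0 // ltW.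
(* Each inequality of an almost type involves two prescribed values, so rational approximation
   raises the defect by [eps / 2]. The strict infimum costs another quarter, and the return to [h]
   and [p] the last one. *)
have d0 : 0 < eps / 4 by rewrite divr_gt0.
have [q qh] := choice (fun i => unit_rat_approx (h01 i) d0).
have [r rp] := unit_rat_approx p01 d0.
pose w := [tuple v i | i < n].
have wE : tnth w = v by apply/funext => i; rewrite tnth_mktuple.
have D'0 : 0 <= D + eps / 2 by lra.
have df : feval (ext_defect q r) w <= D + eps / 2.
  apply/ext_defectP => //; rewrite wE; split.
  - by split => [i|]; exact: unit_rat_itv.
  - by move=> i j; have := qh i; have := qh j; have := hL i j; rewrite !ler_norml; lra.
  - by move=> i j; have := qh i; have := qh j; have := hT i j; rewrite !ler_norml; lra.
  - by move=> i; have := qh i; have := rp; have := hP i; rewrite !ler_norml; lra.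
have ax := iffLR (ext_axiomP q r NS) (NE n q r) w.
have [|y yE] := range_inf_lt (r := D + 3 * eps / 4) N0
    (F := fun y => feval (ext_error q r) [tuple of y :: w]).
  by rewrite (le_lt_trans ax) // (le_lt_trans df) //; lra.
exists y.
have : feval (ext_error q r) [tuple of y :: w] <= D + 3 * eps / 4 by exact: ltW.
have D''0 : 0 <= D + 3 * eps / 4 by lra.
move=> /(iffLR (ext_errorP q r w y NS D''0)); rewrite wE => -[H1 H2]; split.
  by move=> i; have := H1 i; have := qh i; rewrite !ler_norml; lra.
by have := rp; move: H2; rewrite !ler_norml; lra.
Qed.

Lemma model_ext_property (M N : prestructure R unit) :
  is_structure M -> ext_property M -> model (theory M) N -> ext_property N.
Proof.
move=> MS ME [NS MN]; apply/ext_property_axioms => // n q p.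
by apply: MN; move: n q p; apply/ext_property_axioms.
Qed.

End ExtensionAxioms.

(** * Back-and-forth *)

Section Categoricity.
Context {R : realType}.

Lemma dist_le_all (X : metricType R) (x y : X) (C : R) :
  0 < C -> (forall e, 0 < e -> mdist x y <= C * e) -> x = y.
Proof.
move=> C0 H; apply: mdist_positivity; apply/eqP.
rewrite eq_le mdist_ge0 andbT; apply/ler_addgt0Pl => e e0.
have := H (e / C); rewrite divr_gt0 // mulrC divfK ?gt_eqF // addr0; exact.
Qed.

(** The sets [S e] with [e > 0] generate a Cauchy filter, as their diameters tend to 0. This yields
    both limits of sequences and extensions of maps from dense sets. *)
Lemma complete_nested (X : metricType R) (S : R -> set X) (C : R) :
  complete_space X -> 0 < C -> (forall e, 0 < e -> S e !=set0) ->
  (forall e e', e <= e' -> S e `<=` S e') ->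
  (forall e a b, 0 < e -> S e a -> S e b -> mdist a b <= C * e) ->
  exists y, forall e a, 0 < e -> S e a -> mdist a y <= C * e.
Proof.
move=> Xc C0 S0 Sm Sd.
pose F := filter_from [set e : R | 0 < e] S.
have FF : ProperFilter F.
  apply: filter_from_proper => [|e /S0//].
  apply: filter_from_filter; first by exists 1 => /=.
  move=> e e' /= e0 e'0; exists (Num.min e e'); first by rewrite /= lt_min e0.
  by move=> x Sx; split; apply: Sm Sx; rewrite ge_min lexx ?orbT.
have Fc : cauchy F.
  apply: cauchy_exP => e e0; pose e' := e / C / 2.
  have e'0 : 0 < e' by rewrite !divr_gt0.
  have [x Sx] := S0 _ e'0; exists x, e' => // y Sy.
  rewrite ballEmdist /= (le_lt_trans (Sd _ _ _ e'0 Sx Sy)) //.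
  by rewrite /e' mulrA (mulrC C) divfK ?gt_eqF //; lra.
have [y Fy] := Xc F FF Fc; exists y => e a e0 Sa.
apply/ler_addgt0Pl => d d0.
have [e' /= e'0 Se'] := Fy _ (nbhsx_ballx y d d0).
have [|b Sb] := S0 (Num.min e e'); first by rewrite lt_min e0.
have /Se' : S e' b by apply: Sm Sb; rewrite ge_min lexx orbT.
have Sb' : S e b by apply: Sm Sb; rewrite ge_min lexx.
rewrite ballEmdist /= metric_sym => yb.
have := metric_triangle a b y; have := Sd _ _ _ e0 Sa Sb'.
lra.
Qed.

Section ExactExtension.
Context (N : prestructure R unit) (n : nat) (v : 'I_n -> N) (h : 'I_n -> R) (p : R).
Hypotheses (NS : is_structure N) (NE : ext_property N) (vhp : almost_type v h p 0).

Let err (y : N) : R :=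
  Num.max (\big[Num.max/0]_i `|mdist y (v i) - h i|) `|interp tt y - p|.

Let err_le y e : 0 <= e -> err y <= e <-> almost_realizes v h p e y.
Proof.
move=> e0; rewrite /err ge_max; split.
  by move=> /andP[/bigmax_leP[_ H] Hp]; split => // i; exact: H.
by move=> [H Hp]; apply/andP; split => //; apply/bigmax_leP; split.
Qed.

Let err_ge0 y : 0 <= err y.
Proof. by rewrite /err le_max normr_ge0 orbT. Qed.

(* The exact error of y is a legal distance from y to a point realizing the
   prescription, so the new approximation can be found near y. *)
Let improve y e : 0 < e ->
  exists y', err y' <= e /\ mdist y' y <= err y + e.
Proof.
move=> e0; have [_ _ N1 PN] := NS; have [P01 PL] := PN tt.
have [[h01 p01] hL hT hP] := vhp.
have /(err_le y (err_ge0 y))[E1 E2] := lexx (err y).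
have e1 : err y <= 1.
  apply/err_le => //; split.
    move=> i; have := h01 i; have := mdist_ge0 y (v i); have := N1 y (v i).
    by rewrite ler_norml; lra.
  by have := P01 y; rewrite ler_norml; move: p01; lra.
pose v' (i : 'I_n.+1) := if unlift ord0 i is Some j then v j else y.
pose h' (i : 'I_n.+1) := if unlift ord0 i is Some j then h j else err y.
have v'0 : v' ord0 = y by rewrite /v' unlift_none.
have h'0 : h' ord0 = err y by rewrite /h' unlift_none.
have v'S j : v' (lift ord0 j) = v j by rewrite /v' liftK.
have h'S j : h' (lift ord0 j) = h j by rewrite /h' liftK.
have yP : almost_type v' h' p 0.
  split.
  - split => // i; case: (unliftP ord0 i) => [j|] ->; rewrite ?h'0 ?h'S ?err_ge0 //.
  - move=> i j; case: (unliftP ord0 i) => [i'|] ->; case: (unliftP ord0 j) => [j'|] ->;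
      rewrite ?h'0 ?h'S ?v'0 ?v'S ?mdistxx ?addr0 //.
    + have := hL i' j'; lra.
    + by have := E1 i'; rewrite (metric_sym y) ler_norml; lra.
    (* Here [err y] must be bounded by [h j' + mdist y (v j')]; every error entering the maximum is
       compared through [v j']. *)
    + have h0 := h01 j'; have d0 := mdist_ge0 y (v j').
      rewrite /err ge_max; apply/andP; split.
        apply/bigmax_leP; split; first by lra.
        move=> k _; have := hL k j'; have := hT k j'.
        have := metric_triangle (v k) y (v j'); have := metric_triangle y (v j') (v k).
        by rewrite (metric_sym (v j')) (metric_sym _ y) ler_norml; lra.
      have := hP j'; have := PL y (v j'); rewrite !ler_norml; lra.
  - move=> i j; case: (unliftP ord0 i) => [i'|] ->; case: (unliftP ord0 j) => [j'|] ->;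
      rewrite ?h'0 ?h'S ?v'0 ?v'S ?mdistxx ?addr0.
    + have := hT i' j'; lra.
    + by have := E1 i'; rewrite (metric_sym y) ler_norml; lra.
    + by have := E1 j'; rewrite ler_norml; lra.
    + by have := err_ge0 y; lra.
  - move=> i; case: (unliftP ord0 i) => [j|] ->; rewrite ?h'0 ?h'S ?v'0 ?v'S.
    + exact: hP.
    + by rewrite distrC addr0.
have [y' [H1 H2]] := NE (lexx 0) e0 yP; exists y'; split.
  apply/err_le; first exact: ltW.
  split; last by rewrite -[e]add0r.
  by move=> i; have := H1 (lift ord0 i); rewrite h'S v'S add0r.
by have := H1 ord0; rewrite h'0 v'0 ler_norml; lra.
Qed.

(** Iterating [improve] with errors $2^{-k}$ moves the point by summable amounts; the limit exists
    by completeness and has error 0 by continuity. *)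
Lemma exact_extension :
  exists y, (forall i, mdist y (v i) = h i) /\ interp tt y = p.
Proof.
have [y0 /err_le-/(_ _)] := NE (lexx 0) ltr01 vhp; rewrite add0r => /(_ ler01) y0P.
have ge0 k : 0 < (2^-1 : R) ^+ k by rewrite exprn_gt0.
have [f fP] := choice (fun z : N * nat => improve z.1 (ge0 z.2.+1)).
pose fix y k := if k is k'.+1 then f (y k', k') else y0.
have yE k : err (y k) <= 2^-1 ^+ k by case: k => [|k] //=; have [] := fP (y k, k).
have half k : (2^-1 : R) ^+ k = 2^-1 ^+ k.+1 + 2^-1 ^+ k.+1.
  by rewrite exprS; lra.
(* The move at stage [k] is at most $2^{-k} + 2^{-k-1}$, below the drop $4 \cdot 2^{-k-1}$ of $4
   \cdot 2^{-k}$, so the bound telescopes. *)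
have yd k m : mdist (y (k + m)%N) (y k) <= 4 * 2^-1 ^+ k - 4 * 2^-1 ^+ (k + m).
  elim: m => [|m IH]; first by rewrite addn0 mdistxx subrr.
  have [_] := fP (y (k + m)%N, (k + m)%N); rewrite addnS /= => H.
  have := metric_triangle (f (y (k + m)%N, (k + m)%N)) (y (k + m)%N) (y k).
  have := yE (k + m)%N; have := half (k + m)%N; have := ge0 (k + m).+1; lra.
pose S (e : R) := [set x | exists2 k, 2^-1 ^+ k <= e & x = y k].
have yd' e k l : 2^-1 ^+ k <= e -> 2^-1 ^+ l <= e -> mdist (y k) (y l) <= 4 * e.
  wlog kl : k l / (k <= l)%N.
    move=> W ke le; case: (leqP k l) => [/W->//|/ltnW/W]; rewrite metric_sym; exact.
  move=> ke le; have := yd k (l - k)%N; rewrite subnKC // metric_sym.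
  have := ge0 l; lra.
have small (e : R) : 0 < e -> exists k, 2^-1 ^+ k <= e.
  move=> e0; have [k _ Hk] := @near_infty_natSinv_expn_lt R (PosNum e0).
  exists k; have := Hk k (leqnn k) => /=; rewrite exprVn => /ltW.
  by rewrite div1r.
have [||e /small[k ke]|e e' ee' x [k ke ->]|e a b _ [k ke ->] [l le ->]|x xP] :=
    @complete_nested N S 4.
- by have [] := NS.
- by [].
- by exists (y k), k.
- by exists k => //; exact: le_trans ee'.
- exact: yd'.
(* A nearby [y k] has error at most [e] and lies within [4 * e] of the limit. *)
have xE e : 0 < e -> almost_realizes v h p (5 * e) x.
  move=> e0; have [k ke] := small e e0.
  have xk : mdist (y k) x <= 4 * e by apply: xP => //; exists k.
  have /err_le : err (y k) <= e by rewrite (le_trans (yE k)).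
  move=> /(_ (ltW e0)) [H1 H2]; have [_ _ _ PN] := NS; have [_ PL] := PN tt.
  split.
    move=> i; have := H1 i; have := metric_triangle x (y k) (v i).
    have := metric_triangle (y k) x (v i); rewrite (metric_sym x (y k)) !ler_norml; lra.
  have := PL (y k) x; move: H2; rewrite !ler_norml; lra.
have zeroP (z : R) : (forall e, 0 < e -> `|z| <= 5 * e) -> z = 0.
  move=> H; apply/eqP; rewrite -normr_le0; apply/ler_addgt0Pl => e e0.
  by have := H (e / 5); rewrite divr_gt0 // => /(_ isT); lra.
exists x; split.
  by move=> i; apply/eqP; rewrite -subr_eq0; apply/eqP/zeroP => e /xE[].
by apply/eqP; rewrite -subr_eq0; apply/eqP/zeroP => e /xE[].
Qed.

End ExactExtension.

Lemma dense_seqP (X : metricType R) : [set: X] !=set0 -> separable X ->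
  exists s : nat -> X, forall x e, 0 < e -> exists k, mdist x (s k) < e.
Proof.
move=> [x0 _] [D /countable_injP[f fI] Dd].
(* The injection of the dense set into the integers is inverted, with [x0] as default outside its
   image. *)
exists (fun k => xget x0 [set x | D x /\ f x = k]) => x e e0.
have [||y [yO Dy]] := Dd (ball x e)°.
- by exists x; exact: nbhsx_ballx.
- exact: open_interior.
exists (f y); case: xgetP => [z _ [Dz fz]|/(_ y)[]//].
have -> : z = y by apply: fI; rewrite ?inE.
by have := interior_subset yO; rewrite ballEmdist.
Qed.

Section Correspondence.
Context (M N : prestructure R unit) (G : M -> N -> Prop).
Hypotheses (Nc : is_structure N).
Hypotheses (GI : forall a b a' b', G a b -> G a' b' -> mdist b b' = mdist a a').
Hypotheses (GD : forall x e, 0 < e -> exists a b, G a b /\ mdist x a < e).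

(** As [G] is isometric, the partners of points within [e] of [x] form a set of diameter at most
    [2 * e]; [f x] is the limit of these sets. *)
Lemma correspondence_extension : exists f : M -> N,
  forall x a b e, 0 < e -> G a b -> mdist x a < e -> mdist b (f x) <= 2 * e.
Proof.
have [_ Nc' _ _] := Nc.
suff H x : exists y, forall a b e, 0 < e -> G a b -> mdist x a < e ->
    mdist b y <= 2 * e by have [f fP] := choice H; exists f.
have [//|e e0|e e' ee' b [a Gab xa]|e b b' e0 [a Gab xa] [a' Gab' xa']|y yP] :=
  @complete_nested N (fun e => [set b | exists2 a, G a b & mdist x a < e]) 2 Nc'.
- by have [a [b [Gab xa]]] := GD x e0; exists b, a.
- by exists a => //; exact: lt_le_trans ee'.
- rewrite (GI Gab Gab'); have := metric_triangle a x a'.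
  by rewrite (metric_sym a x); lra.
- by exists y => a b e e0 Gab xa; apply: yP => //; exists a.
Qed.

End Correspondence.

(** The relation extends by continuity in both directions, and the two extensions are mutually
    inverse because both stay close to [G]. *)
Lemma correspondence_isomorphic (M N : prestructure R unit) (G : M -> N -> Prop) :
  is_structure M -> is_structure N ->
  (forall a b a' b', G a b -> G a' b' -> mdist b b' = mdist a a') ->
  (forall a b, G a b -> interp tt b = interp tt a) ->
  (forall x e, 0 < e -> exists a b, G a b /\ mdist x a < e) ->
  (forall y e, 0 < e -> exists a b, G a b /\ mdist y b < e) ->
  isomorphic M N.
Proof.
move=> MS NS GI GP GM GN.
have [f fP] := correspondence_extension NS GI GM.
have [g gP] : exists g : N -> M, forall y b a e, 0 < e -> G a b ->
    mdist y b < e -> mdist a (g y) <= 2 * e.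
  apply: (@correspondence_extension N M (fun b a => G a b) MS).
    by move=> b a b' a' Gab Gab'; rewrite (GI _ _ _ _ Gab Gab').
  by move=> y e e0; have [a [b [Gab yb]]] := GN y e e0; exists b, a.
have gf x : g (f x) = x.
  (* [f x] is within [2 * e], hence less than [3 * e], of [b]; so [g (f x)] is within [6 * e] of
     [a], which is within [e] of [x]. *)
  apply: (@dist_le_all _ _ _ 7) => // e e0.
  have [a [b [Gab xa]]] := GM x e e0.
  have bf := fP x a b e e0 Gab xa.
  have := gP (f x) b a (3 * e); rewrite mulr_gt0 // (metric_sym (f x)).
  move=> /(_ isT Gab) H; have /H {}H : mdist b (f x) < 3 * e by lra.
  have := metric_triangle (g (f x)) a x.
  by rewrite (metric_sym _ a) (metric_sym a x); lra.
have fg y : f (g y) = y.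
  apply: (@dist_le_all _ _ _ 7) => // e e0.
  have [a [b [Gab yb]]] := GN y e e0.
  have ag := gP y b a e e0 Gab yb.
  have := fP (g y) a b (3 * e); rewrite mulr_gt0 // (metric_sym (g y)).
  move=> /(_ isT Gab) H; have /H {}H : mdist a (g y) < 3 * e by lra.
  have := metric_triangle (f (g y)) b y.
  by rewrite (metric_sym _ b) (metric_sym b y); lra.
(* Each of two points contributes [e] in [M] and [2 * e] in [N]. *)
have zeroP (z : R) : (forall e, 0 < e -> `|z| <= 6 * e) -> z = 0.
  move=> H; apply/eqP; rewrite -normr_le0; apply/ler_addgt0Pl => e e0.
  by have := H (e / 6); rewrite divr_gt0 // => /(_ isT); lra.
exists f; split; last by exists g.
split=> [x x'|[] x]; apply/eqP; rewrite -subr_eq0; apply/eqP/zeroP => e e0.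
  have [a [b [Gab xa]]] := GM x e e0; have [a' [b' [Gab' xa']]] := GM x' e e0.
  have bf := fP x a b e e0 Gab xa; have bf' := fP x' a' b' e e0 Gab' xa'.
  have ba := GI _ _ _ _ Gab Gab'.
  have := metric_triangle x a x'; have := metric_triangle a a' x'.
  have := metric_triangle a x a'; have := metric_triangle x x' a'.
  have := metric_triangle (f x) b (f x'); have := metric_triangle b b' (f x').
  have := metric_triangle b (f x) b'; have := metric_triangle (f x) (f x') b'.
  rewrite (metric_sym a' x') (metric_sym a x) (metric_sym (f x) b).
  rewrite (metric_sym (f x') b') ler_norml.
  lra.
have [a [b [Gab xa]]] := GM x e e0.
have bf := fP x a b e e0 Gab xa; have ba := GP _ _ Gab.
have [_ _ _ /(_ tt)[_ PL]] := MS; have [_ _ _ /(_ tt)[_ QL]] := NS.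
have := PL x a; have := QL b (f x); rewrite !ler_norml ba; lra.
Qed.

(** Preservation of distances already forces the list to be the graph of an injective map. *)
Definition partial_iso (M N : prestructure R unit) (s : seq (M * N)) : Prop :=
  (forall z w, z \in s -> w \in s -> mdist z.2 w.2 = mdist z.1 w.1) /\
  (forall z, z \in s -> interp tt z.2 = interp tt z.1).

Lemma partial_iso_swap (M N : prestructure R unit) (s : seq (M * N)) :
  partial_iso s -> @partial_iso N M [seq (z.2, z.1) | z <- s].
Proof.
move=> [sI sP]; split; first move=> _ _ /mapP[z zs ->] /mapP[w ws ->] /=.
  by rewrite sI.
by move=> _ /mapP[z zs ->] /=; rewrite sP.
Qed.

(** The distances from [a] to the first coordinates and the value of [P] at [a], transported along
    [s], form a prescription of defect 0 over the second coordinates. *)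
Lemma partial_iso_forth (M N : prestructure R unit) (s : seq (M * N)) (a : M) :
  is_structure M -> is_structure N -> ext_property N -> partial_iso s ->
  exists b, partial_iso ((a, b) :: s).
Proof.
move=> [_ _ M1 /(_ tt)[P01 PL]] NS NE [sI sP].
pose z i := tnth (in_tuple s) i.
have zs i : z i \in s by exact: mem_tnth.
have [|b [bI bP]] := @exact_extension N _ (fun i => (z i).2)
    (fun i => mdist a (z i).1) (interp tt a) NS NE.
  split=> [|i j|i j|i]; rewrite ?addr0.
  - by split => // i; rewrite mdist_ge0 M1.
  - rewrite sI // (le_trans (metric_triangle a (z j).1 _)) //.
    by rewrite (metric_sym (z j).1).
  - rewrite sI // (le_trans (metric_triangle _ a _)) //.
    by rewrite (metric_sym _ a).
  - by rewrite sP.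
have bs w : w \in s -> mdist b w.2 = mdist a w.1.
  by move=> ws; have /tnthP[i ->] : w \in in_tuple s by []; exact: bI.
exists b; split.
  move=> u w; rewrite !inE => /orP[/eqP->|us] /orP[/eqP->|ws] /=.
  - by rewrite !mdistxx.
  - exact: bs.
  - by rewrite metric_sym bs // metric_sym.
  - exact: sI.
by move=> w; rewrite inE => /orP[/eqP->|ws] //=; exact: sP.
Qed.

Lemma partial_iso_back (M N : prestructure R unit) (s : seq (M * N)) (b : N) :
  is_structure M -> is_structure N -> ext_property M -> partial_iso s ->
  exists a, partial_iso ((a, b) :: s).
Proof.
move=> MS NS ME /partial_iso_swap /(partial_iso_forth b NS MS ME)[a].
move=> /partial_iso_swap /=; rewrite -map_comp => H; exists a.
rewrite (_ : [seq _ | z <- s] = s) // in H.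
by rewrite -[RHS]map_id; apply: eq_map => -[].
Qed.

(** Back-and-forth along dense sequences: stage [k] adds [a k] to the domain and [b k] to the range,
    so the union of the stages is a correspondence with dense projections. *)
Lemma ext_property_isomorphic (M N : prestructure R unit) :
  is_structure M -> is_structure N -> separable M -> separable N ->
  ext_property M -> ext_property N -> isomorphic M N.
Proof.
move=> MS NS Msep Nsep ME NE.
have [M0 _ _ _] := MS; have [N0 _ _ _] := NS.
have [a aD] := dense_seqP M0 Msep; have [b bD] := dense_seqP N0 Nsep.
have [f fP] : exists f : seq (M * N) * nat -> M * N, forall z, partial_iso z.1 ->
    partial_iso [:: ((f z).1, b z.2), (a z.2, (f z).2) & z.1].
  suff H (z : seq (M * N) * nat) : exists w : M * N, partial_iso z.1 ->
      partial_iso [:: (w.1, b z.2), (a z.2, w.2) & z.1].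
    by have [f fP] := choice H; exists f.
  (* [choice] needs an answer for every list; lists that are not partial isomorphisms get an
     arbitrary pair. *)
  case: z => s k /=; have [sI|?] := pselect (partial_iso s); last first.
    by have [x _] := M0; have [y _] := N0; exists (x, y).
  have [y yP] := partial_iso_forth (a k) MS NS NE sI.
  have [x xP] := partial_iso_back (b k) MS NS ME yP.
  by exists (x, y).
pose fix s k := if k is k'.+1 then
  [:: ((f (s k', k')).1, b k'), (a k', (f (s k', k')).2) & s k'] else [::].
have sI k : partial_iso (s k) by elim: k => //= k IH; exact: (fP (s k, k)).
have sm k l z : z \in s k -> z \in s (l + k)%N.
  by elim: l => // l IH /IH H; rewrite /= !inE H !orbT.
pose G x y := exists k, (x, y) \in s k.
apply: (@correspondence_isomorphic M N G) => //.
- move=> x y x' y' [k zs] [l ws]; have [sI' _] := sI (k + l)%N.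
  by apply: (sI' (x, y) (x', y')); [rewrite addnC|]; exact: sm.
- by move=> x y [k zs]; have [_ /(_ _ zs)] := sI k.
- move=> x e e0; have [k xk] := aD x e e0; exists (a k), (f (s k, k)).2.
  by split => //; exists k.+1; rewrite /= !inE eqxx orbT.
- move=> y e e0; have [k yk] := bD y e e0; exists (f (s k, k)).1, (b k).
  by split => //; exists k.+1; rewrite /= !inE eqxx.
Qed.

End Categoricity.

(** * Approximate quantifier elimination and distances between types *)

Section Continuity.
Context {R : realType}.
Implicit Types N : prestructure R unit.

Definition close_tuples N n (u v : n.-tuple N) (d : R) : Prop :=
  (forall i j, `|mdist (tnth u i) (tnth u j) - mdist (tnth v i) (tnth v j)| <= d) /\
  (forall i, `|interp tt (tnth u i) - interp tt (tnth v i)| <= d).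

Lemma close_tuples_sym N n (u v : n.-tuple N) d :
  close_tuples u v d -> close_tuples v u d.
Proof. by move=> [H1 H2]; split=> [i j|i]; rewrite distrC. Qed.

(** This is the forth step up to errors: what [x] satisfies over [u] has defect [d / 2] over [v],
    and its realization adds another [d / 2]. *)
Lemma close_tuples_extend N n (u v : n.-tuple N) d (x : N) :
  is_structure N -> ext_property N -> 0 < d -> close_tuples u v (d / 2) ->
  exists y, close_tuples [tuple of x :: u] [tuple of y :: v] d.
Proof.
move=> [_ _ N1 /(_ tt)[P01 PL]] NE d0 [cI cP].
have d20 : 0 < d / 2 by rewrite divr_gt0.
have [|y [yI yP]] := @NE n (tnth v) (fun i => mdist x (tnth u i)) (interp tt x)
    _ _ (ltW d20) d20.
  split=> [|i j|i j|i].
  - by split => // i; rewrite mdist_ge0 N1.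
  - have := metric_triangle x (tnth u j) (tnth u i); have := cI j i.
    by rewrite (metric_sym (tnth v i)) ler_norml; lra.
  - have := metric_triangle (tnth u i) x (tnth u j); have := cI i j.
    by rewrite (metric_sym _ x) ler_norml; lra.
  - have := PL x (tnth u i); have := cP i; rewrite !ler_norml; lra.
rewrite -splitr in yI yP.
exists y; split=> [i j|i].
  case: (unliftP ord0 i) => [i'|] ->; case: (unliftP ord0 j) => [j'|] ->;
    rewrite ?tnthS ?tnth0 ?mdistxx ?subrr ?normr0 ?(ltW d0) //.
  - by rewrite (le_trans (cI _ _)) //; lra.
  - by rewrite distrC (metric_sym _ x) (metric_sym _ y).
  - by rewrite distrC.
case: (unliftP ord0 i) => [i'|] ->; rewrite ?tnthS ?tnth0 1?distrC //.
by rewrite distrC (le_trans (cP _)) //; lra.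
Qed.

(** [d] is chosen before [N], so the modulus is uniform over all structures; closeness is symmetric,
    so a one-sided bound suffices. *)
Definition controlled n (phi : formula unit n) : Prop :=
  forall eps : R, 0 < eps -> exists d : R, 0 < d /\
    forall N, is_structure N -> ext_property N ->
    forall u v : n.-tuple N, close_tuples u v d -> feval phi u <= feval phi v + eps.

(** Connectives are Lipschitz with some constant [c]; the unary ones are covered by taking [psi]
    equal to [phi]. *)
Lemma controlled2 n (phi psi chi : formula unit n) (c : R) :
  0 < c -> controlled phi -> controlled psi ->
  (forall N (u v : n.-tuple N) e, 0 < e -> is_structure N ->
     `|feval phi u - feval phi v| <= e -> `|feval psi u - feval psi v| <= e ->
     feval chi u <= feval chi v + c * e) ->
  controlled chi.
Proof.
move=> c0 cphi cpsi H e e0.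
have ec0 : 0 < e / c by rewrite divr_gt0.
have [d [d0 dP]] := cphi _ ec0; have [d' [d'0 dP']] := cpsi _ ec0.
exists (Num.min d d'); split; first by rewrite lt_min d0.
move=> N NS NE u v [cI cP].
have uv : close_tuples u v d.
  by split=> [i j|i]; [have := cI i j|have := cP i]; rewrite le_min => /andP[].
have uv' : close_tuples u v d'.
  by split=> [i j|i]; [have := cI i j|have := cP i]; rewrite le_min => /andP[].
have -> : e = c * (e / c) by rewrite mulrC divfK ?gt_eqF.
have vu := close_tuples_sym uv; have vu' := close_tuples_sym uv'.
apply: H => //.
  have := dP N NS NE _ _ uv; have := dP N NS NE _ _ vu; rewrite ler_norml; lra.
have := dP' N NS NE _ _ uv'; have := dP' N NS NE _ _ vu'; rewrite ler_norml; lra.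
Qed.

(* Approximate quantifier elimination: the value of a formula is determined by
   the distances and by the values of P, uniformly in the structure. *)
Lemma formula_controlled n (phi : formula unit n) : controlled phi.
Proof.
elim: phi => {n}.
- move=> n i j e e0; exists e; split => // N _ _ u v [/(_ i j) + _].
  by rewrite ler_norml /=; lra.
- move=> n [] i e e0; exists e; split => // N _ _ u v [_ /(_ i)].
  by rewrite ler_norml /=; lra.
- move=> n phi IH; apply: (controlled2 ltr01 IH IH) => N u v e _ _ + _.
  by rewrite ler_norml /=; lra.
- move=> n phi IH; apply: (controlled2 ltr01 IH IH) => N u v e e0 _ + _.
  by rewrite ler_norml /=; lra.
- move=> n phi IH psi IH'; apply: (controlled2 (ltr0n R 2) IH IH').
  move=> N u v e e0 _; rewrite !ler_norml /= /monus.
  case: (leP (feval phi u - feval psi u) 0);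
    case: (leP (feval phi v - feval psi v) 0); lra.
- move=> n phi IH psi IH'; apply: (controlled2 ltr01 IH IH').
  move=> N u v e e0 _; rewrite !ler_norml /=.
  by case: (leP (feval phi u)); case: (leP (feval phi v)); lra.
- move=> n phi IH psi IH'; apply: (controlled2 ltr01 IH IH').
  move=> N u v e e0 _; rewrite !ler_norml /=.
  by case: (leP (feval phi u)); case: (leP (feval phi v)); lra.
- move=> n q phi IH.
  have q0 : 0 < ratr q%:num :> R by rewrite ltr0q.
  apply: (controlled2 q0 IH IH) => N u v e e0 _ + _; rewrite ler_norml /= => H.
  have : ratr q%:num * feval phi u <= ratr q%:num * feval phi v + ratr q%:num * e.
    by rewrite -mulrDr ler_pM2l //; lra.
  have : 0 < ratr q%:num * e by rewrite mulr_gt0.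
  by case: (leP 1 (_ * feval phi u)); case: (leP 1 (_ * feval phi v)); lra.
(* Every [x] over [u] is answered by a [y] over [v], at the cost of halving the modulus. *)
- move=> n phi IH e e0; have [d [d0 dP]] := IH e e0.
  exists (d / 2); split; first by rewrite divr_gt0.
  move=> N NS NE u v uv /=; have [N0 _ _ _] := NS.
  apply: range_sup_le => // x.
  have [y xy] := close_tuples_extend x NS NE d0 uv.
  rewrite (le_trans (dP _ NS NE _ _ xy)) // lerD2r.
  apply: (@range_sup_ge _ _ (fun y => feval phi [tuple of y :: v])) => z.
  exact: feval_itv.
(* For the infimum the direction is reversed: a given [y] over [v] is answered by an [x] over
   [u]. *)
- move=> n phi IH e e0; have [d [d0 dP]] := IH e e0.
  exists (d / 2); split; first by rewrite divr_gt0.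
  move=> N NS NE u v uv /=; have [N0 _ _ _] := NS.
  rewrite -lerBlDr; apply: range_inf_ge => // y.
  have [x xy] := close_tuples_extend y NS NE d0 (close_tuples_sym uv).
  rewrite lerBlDr (le_trans _ (dP _ NS NE _ _ (close_tuples_sym xy))) //.
  apply: (@range_inf_le _ _ (fun y => feval phi [tuple of y :: u])) => z.
  exact: feval_itv.
Qed.

End Continuity.

Section TypeDistance.
Context {R : realType} {S : Type}.

Lemma tp_monus (N : prestructure R S) n (c : n.-tuple N) (phi psi : formula S n) :
  tp c (FMonus phi psi) <-> feval phi c <= feval psi c.
Proof. by rewrite -monus_eq0; split=> [/eqP|] // /eqP. Qed.

(** Inclusion of types suffices: a rational strictly between two different distances gives a
    condition true at [b] and false at [c]. *)
Lemma realizes_tp_dist (M N : prestructure R S) n (c : n.-tuple N)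
    (b : n.-tuple M) i j :
  is_structure M -> is_structure N -> realizes c (tp b) ->
  mdist (tnth c i) (tnth c j) = mdist (tnth b i) (tnth b j).
Proof.
move=> MS NS cb; have [_ _ M1 _] := MS; have [_ _ N1 _] := NS.
(* The separating rational lies below a distance, hence below 1, where the cap in [unit_rat] has no
   effect. *)
have uE (q : {posnum rat}) (x : R) : ratr q%:num < x -> x <= 1 ->
    unit_rat q = ratr q%:num :> R.
  by move=> qx x1; rewrite /unit_rat min_r // ltW // (lt_le_trans qx).
apply/eqP; rewrite eq_le; apply/andP; split; rewrite leNgt; apply/negP.
  move=> /rat_in_itvoo[q]; rewrite in_itv /= => /andP[bq qc].
  have q0 : 0 < q by rewrite -(ltr0q R) (le_lt_trans _ bq) // mdist_ge0.
  have qE : unit_rat (PosNum q0) = ratr q :> R by rewrite (uE (PosNum q0) _ qc) ?N1.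
  have /cb/tp_monus : tp b (FMonus (FDist S i j) (Fconst n (PosNum q0))).
    by apply/tp_monus; rewrite feval_const // qE ltW.
  by rewrite feval_const // qE leNgt qc.
move=> /rat_in_itvoo[q]; rewrite in_itv /= => /andP[cq qb].
have q0 : 0 < q by rewrite -(ltr0q R) (le_lt_trans _ cq) // mdist_ge0.
have qE : unit_rat (PosNum q0) = ratr q :> R by rewrite (uE (PosNum q0) _ qb) ?M1.
have /cb/tp_monus : tp b (FMonus (Fconst n (PosNum q0)) (FDist S i j)).
  by apply/tp_monus; rewrite feval_const // qE ltW.
by rewrite feval_const // qE leNgt cq.
Qed.

(** Types determine distances, so these can be compared on nearly optimal realizations in a common
    model; moving both endpoints doubles the error. *)
Lemma type_dist_le (M : prestructure R S) n (c b : n.-tuple M) e i j :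
  is_structure M -> type_dist R (theory M) (tp c) (tp b) <= e ->
  `|mdist (tnth c i) (tnth c j) - mdist (tnth b i) (tnth b j)| <= 2 * e.
Proof.
move=> MS ce; apply/ler_addgt0Pl => d d0.
set D := [set r : R | exists (N : prestructure R S) (c' b' : n.-tuple N),
  [/\ model (theory M) N, realizes c' (tp c), realizes b' (tp b)
    & r = tuple_dist c' b']] in ce.
(* The realizations [c] and [b] in [M] itself make the set nonempty, so its infimum is not the
   default value. *)
have D0 : has_inf D.
  split; first by exists (tuple_dist c b), M, c, b; split => //; split.
  exists 0 => _ [N [c' [b' [_ _ _ ->]]]].
  exact: bigmax_ge_id.
have d20 : 0 < d / 2 by rewrite divr_gt0.
have [_ [N [c' [b' [[NS _] cc' bb' ->]]]] lt] := inf_adherent d20 D0.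
have dist_le k : mdist (tnth c' k) (tnth b' k) <= e + d / 2.
  rewrite (le_trans _ (le_trans (ltW lt) _)) ?lerD2r //.
  exact: (@le_bigmax _ _ _ 0 (fun k => mdist (tnth c' k) (tnth b' k))).
rewrite -(realizes_tp_dist i j MS NS cc') -(realizes_tp_dist i j MS NS bb').
have := dist_le i; have := dist_le j.
have := metric_triangle (tnth c' i) (tnth b' i) (tnth c' j).
have := metric_triangle (tnth b' i) (tnth b' j) (tnth c' j).
have := metric_triangle (tnth b' i) (tnth c' i) (tnth b' j).
have := metric_triangle (tnth c' i) (tnth c' j) (tnth b' j).
rewrite (metric_sym (tnth b' i) (tnth c' i)) (metric_sym (tnth b' j) (tnth c' j)).
rewrite ler_norml; lra.
Qed.

Lemma feval_iso (M N : prestructure R S) (f : M -> N) n (phi : formula S n)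
    (v : n.-tuple M) :
  embedding f -> bijective f -> feval phi [tuple of map f v] = feval phi v.
Proof.
move=> [fI fP] [g fg gf]; elim: phi v => {n} /=.
- by move=> n i j v; rewrite !tnth_map fI.
- by move=> n a i v; rewrite tnth_map fP.
- by move=> n phi IH v; rewrite IH.
- by move=> n phi IH v; rewrite IH.
- by move=> n phi IH psi IH' v; rewrite IH IH'.
- by move=> n phi IH psi IH' v; rewrite IH IH'.
- by move=> n phi IH psi IH' v; rewrite IH IH'.
- by move=> n q phi IH v; rewrite IH.
- move=> n phi IH v; congr sup; apply/seteqP; split => _ [x _ <-].
    exists (g x) => //; rewrite -IH; congr feval; apply: val_inj => /=.
    by rewrite gf.
  by exists (f x) => //; rewrite -IH; congr feval; apply: val_inj.
- move=> n phi IH v; congr inf; apply/seteqP; split => _ [x _ <-].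
    exists (g x) => //; rewrite -IH; congr feval; apply: val_inj => /=.
    by rewrite gf.
  by exists (f x) => //; rewrite -IH; congr feval; apply: val_inj.
Qed.

End TypeDistance.

(** * Stability *)

Section Stability.
Context {R : realType}.

Lemma truncn_close (x y : R) K : 0 <= x -> 0 <= y ->
  Num.truncn (x * K.+1%:R) = Num.truncn (y * K.+1%:R) -> `|x - y| <= K.+1%:R^-1.
Proof.
move=> x0 y0 xy.
have k0 : 0 < K.+1%:R :> R by rewrite ltr0Sn.
have /truncn_itv : 0 <= x * K.+1%:R by rewrite mulr_ge0 // ltW.
have /truncn_itv : 0 <= y * K.+1%:R by rewrite mulr_ge0 // ltW.
rewrite xy; set z := Num.truncn _; rewrite -[z.+1%:R]natr1 => H1 H2.
rewrite -(ler_pM2r k0) mulVf ?gt_eqF // -(gtr0_norm k0) -normrM mulrBl.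
by rewrite ler_norml; lra.
Qed.

(** The cube $[0,1]^m$ is cut into cells of side $1/(K+1)$, and one more index than cells is
    taken. *)
Lemma unit_tuples_pigeonhole m K :
  exists n, forall f : 'I_n -> 'I_m -> R, (forall i k, 0 <= f i k <= 1) ->
    exists i j : 'I_n, (i < j)%N /\ forall k, `|f i k - f j k| <= K.+1%:R^-1.
Proof.
(* The value 1 truncates to [K.+1], so each coordinate needs [K.+2] cells. *)
pose T := {ffun 'I_m -> 'I_K.+2}.
exists #|T|.+1 => f f01.
pose col (i : 'I_#|T|.+1) : T :=
  [ffun k => inord (Num.truncn (f i k * K.+1%:R))].
have colP i j k : col i = col j -> `|f i k - f j k| <= K.+1%:R^-1.
  move=> /ffunP/(_ k); rewrite !ffunE => /(congr1 val).
  have small l : (Num.truncn (f l k * K.+1%:R) < K.+2)%N.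
    have /andP[f0 f1] := f01 l k.
    rewrite truncn_lt_nat ?mulr_ge0 // (@le_lt_trans _ _ K.+1%:R) ?ltr_nat //.
    by rewrite ler_piMl.
  rewrite /= !inordK //; apply: truncn_close; [by have /andP[] := f01 i k|].
  by have /andP[] := f01 j k.
have /injectivePn[i [j ij cij]] : ~~ injectiveb col.
  apply/negP => /injectiveP/leq_card; by rewrite card_ord ltnn.
have [lt|gt|/val_inj/eqP] := ltngtP i j; last by rewrite (negPf ij).
- by exists i, j; split => // k; exact: colP.
- by exists j, i; split => // k; exact: colP.
Qed.

Lemma ext_property_stable (U : metricType R) (D : set U) (Y : set (lstruct U)) :
  is_structure (pure_metric U) ->
  (forall A, Y A -> is_structure (with_pred A) /\ ext_property (with_pred A)) ->
  relatively_stable D Y.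
Proof.
move=> US YE m k phi s s' _ _ [r1 [r2 [r10 r12 r21 H]]].
have rr : ratr r1 < ratr r2 :> R by rewrite ltr_rat.
(* The gap would be at most [eta] from the modulus plus twice the tolerance [q < eta], less than the
   four quarters available. *)
pose eta : R := (ratr r2 - ratr r1) / 4.
have eta0 : 0 < eta by rewrite divr_gt0 // subr_gt0.
have [d [d0 dP]] := formula_controlled phi eta0.
have [K Kd] : exists K, K.+1%:R^-1 <= d.
  exists (Num.truncn d^-1).
  by rewrite -[leRHS]invrK lef_pV2 ?posrE ?invr_gt0 // ltW // truncnS_gt.
have [n nP] := unit_tuples_pigeonhole (m + k) K.
(* Two distances, each within [2 * q] of the one in [s ++ s'], differ by at most [4 * q < d]. *)
have /rat_in_itvoo[q] : 0 < Num.min 1 (Num.min eta (d / 4)).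
  by rewrite !lt_min ltr01 eta0 divr_gt0.
rewrite in_itv /= !lt_min => /andP[q0 /and3P[q1 qeta qd]].
have q01 : 0 < q <= 1.
  by rewrite -(ltr0q R) q0 -(ler_rat R) rmorph1 ltW.
have [t [t' [_ tt' [A YA AP]]]] := H n q q01.
have [AS AE] := YE A YA; have [_ _ _ /(_ tt)[A01 _]] := AS.
(* The pigeonhole is applied to the values of [P] on the diagonal tuples [t i ++ t' i]. *)
have [i [j [ij ijP]]] :=
  nP (fun i l => A (tnth [tuple of t i ++ t' i] l)) (fun i l => A01 _).
rewrite ltr_pdivlMr // in qd.
have eta4 : eta * 4 = ratr r2 - ratr r1 by rewrite divfK.
pose g a b l l' : R := @mdist R U (tnth [tuple of t a ++ t' b] l)
  (tnth [tuple of t a ++ t' b] l').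
have gP a b l l' : `|g a b l l' - @mdist R U (tnth [tuple of s ++ s'] l)
    (tnth [tuple of s ++ s'] l')| <= 2 * ratr q.
  exact: type_dist_le US (tt' a b).
have close : @close_tuples _ (with_pred A) _ [tuple of t j ++ t' i]
    [tuple of t i ++ t' j] d.
  split=> [l l'|l].
    rewrite -[_ - _]/(g j i l l' - g i j l l').
    by have := gP i j l l'; have := gP j i l l'; rewrite !ler_norml; lra.
  rewrite (le_trans _ Kd) //.
  (* Each block of the mixed tuples is a block of a diagonal tuple, where [P] has been compared. *)
  have := ijP l; case: (split_ordP l) => l' ->; rewrite ?tnth_lshift ?tnth_rshift //.
  by rewrite distrC.
pose a x y : R := @feval R unit (with_pred A) _ phi [tuple of t x ++ t' y].
have : a j i <= a i j + eta := dP _ AS AE _ _ close.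
have [/(_ ij) + _] := AP i j; have [_ /(_ (ltnW ij))] := AP j i.
rewrite -!/(a _ _) !monus_le ?(ltW q0) //; lra.
Qed.

End Stability.

(** * Closedness and invariance of the set of models *)

Section Topology.
Context {R : realType} (U : metricType R).
Implicit Types A : lstruct U.

(** Basic open sets bound formulas from above only, so a failing condition [phi = 0] is detected by
    [FCompl phi] staying below some rational [r < 1]. *)
Lemma models_on_closed (D : set U) (T : set (formula unit 0)) :
  (forall A, is_structure (with_pred A)) ->
  closed (models_on T : set (lspace D)).
Proof.
move=> US; rewrite -openC.
pose B := [set E | @t_basis R U D E /\ E `<=` ~` (models_on T : set (lspace D))].
exists B; first by move=> E [].
apply/seteqP; split => [A [E [_ +] EA]|A nA]; first exact.
have [phi Tphi phiA] : exists2 phi, T phi & ~ theory (with_pred A) phi.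
  apply: contrapT => H; apply: nA; split => // phi Tphi.
  by apply: contrapT => ?; apply: H; exists phi.
have /andP[p0 p1] := feval_itv phi ([tuple] : 0.-tuple (with_pred A)) (US A).
have pgt0 : 0 < feval phi ([tuple] : 0.-tuple (with_pred A)).
  by rewrite lt_neqAle p0 andbT eq_sym; apply/eqP.
have /rat_in_itvoo[r] : 1 - feval phi ([tuple] : 0.-tuple (with_pred A)) < 1.
  by rewrite ltrBlDr ltrDl.
rewrite in_itv /= => /andP[pr r1].
exists [set A' : lstruct U |
    @feval R unit (with_pred A') 0 (FCompl phi) [tuple] < ratr r] => //.
split.
  exists 0%N, (FCompl phi), [tuple], r; split => //; first by move=> -[].
  rewrite -(ltr0q R) -(ltr_rat R r 1) rmorph1 r1 andbT.
  by rewrite (le_lt_trans _ pr) // subr_ge0.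
move=> A' /= A'r [_ /(_ _ Tphi)]; rewrite /theory /= => p'0.
by move: A'r; rewrite p'0 subr0 ltNge ltW.
Qed.

Lemma models_on_invariant (T : set (formula unit 0)) :
  (forall A, is_structure (with_pred A)) ->
  iso_invariant (models_on T : set (lstruct U)).
Proof.
move=> US g A B [gI gb] AB [_ TA]; split => // phi /TA; rewrite /theory /= => <-.
have gE : @embedding R unit (with_pred A) (with_pred B) g by split.
by rewrite -(feval_iso phi [tuple] gE gb); congr feval; apply: val_inj.
Qed.

End Topology.

Theorem theorem4p15 (R : realType) (U QU : metricType R) (iota : QU -> U)
    (P : lstruct U) :
  urysohn U -> rational_urysohn QU -> standard_embedding iota ->
  fraisse_limit (@classK R) (with_pred P) ->
  let T := theory (with_pred P) in
  let Y_P : set (lstruct U) := models_on T in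
  separably_categorical R T /\
  [/\ closed (Y_P : set (lspace (range iota))),
      iso_invariant Y_P
    & relatively_stable (range iota) Y_P].
Proof.
move=> _ _ _ PF T Y; have [PS Psep _ _] := PF; have PE := fraisse_limit_ext PF.
have [U0 Uc U1 _] := PS.
(* All structures on [U] share their metric part, which is read off from the limit. *)
have US (A : lstruct U) : is_structure (with_pred A).
  by split => // -[]; exact: lpredP.
split; last split.
- exists (with_pred P); split=> [|//|N NT Nsep]; first by split.
  apply: ext_property_isomorphic => //; first by have [] := NT.
  exact: model_ext_property NT.
- exact: models_on_closed.
- exact: models_on_invariant.
- apply: ext_property_stable; first by split.
  by move=> A YA; split => //; exact: model_ext_property YA.
Qed.
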